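(* For every integer $n \geq 2$ and every real $\alpha \in [0,1]$ with $\alpha < \lVert R_{2n}^4\rVert$, the class $\mathcal{G}(R_{2n},\alpha)$ of all intersection graphs of $\alpha$-free homothetic copies of the regular $2n$-gon $R_{2n}$ does not admit product structure.
   Context: All graphs and collections are finite. $\lVert S\rVert$ denotes the area of $S \subseteq \mathbb{R}^2$. Regular polygons: for an integer $N\ge 3$, $R_N\subseteq\mathbb{R}^2$ is a fixed (closed, filled) regular $N$-gon of area $\lVert R_N\rVert = 1$. For $m\le N$, $R_N^m\subseteq R_N$ is the convex hull of $m$ consecutive corners of $R_N$; thus $\lVert R_N^m\rVert\in[0,1]$. $\alpha$-free: a homothetic copy of $S\subseteq\mathbb{R}^2$ is a set obtained from $S$ by positive scaling and translation. For $\alpha \in[0,1]$, a collection $\{S_v\}_{v\in V}$ of homothetic copies of $S$ is $\alpha$-free if for every $v\in V$ we have $\lVert S_v \setminus \bigcup_{u\in V\setminus\{v\}} S_u\rVert \ge \alpha\lVert S_v\rVert$. The intersection graph of the collection has vertex set $V$ and an edge $uv$ (for $u\neq v$) if and only if $S_u\cap S_v\neq\emptyset$. $\mathcal{G}(S,\alpha)$ is the class of all intersection graphs of $\alpha$-free collections of homothetic copies of $S$. Product structure: the strong product $G\boxtimes H$ has vertex set $V(G)\times V(H)$, with distinct vertices $(u,u'),(v,v')$ adjacent iff ($u=v$ or $uv\in E(G)$) and ($u'=v'$ or $u'v'\in E(H)$). A graph class $\mathcal{G}$ admits product structure if there is a constant $t$ such that every $G\in\mathcal{G}$ is a subgraph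 of $H\boxtimes P$ for some path $P$ and some graph $H$ of treewidth at most $t$. *)

(* Defs.v *)
From mathcomp Require Import all_boot all_order all_algebra.
From mathcomp Require Import all_classical all_reals all_analysis.

Set Implicit Arguments.
Unset Strict Implicit.
Unset Printing Implicit Defensive.

Import Order.TTheory GRing.Theory Num.Theory.

Local Open Scope classical_set_scope.
Local Open Scope ring_scope.

Record sgraph := SGraph {
  vertex :> finType;
  edge : rel vertex;
  edge_sym : symmetric edge;
  edge_irr : irreflexive edge }.

Definition subgraph (G H : sgraph) : Prop :=
  exists f : G -> H, injective f /\
    forall u v : G, edge u v -> edge (f u) (f v).

Section StrongProduct.
Variables G H : sgraph.

Definition strong_rel : rel (G * H)%type := fun x y =>
  [&& x != y, (x.1 == y.1) || edge x.1 y.1 & (x.2 == y.2) || edge x.2 y.2].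

Lemma strong_rel_sym : symmetric strong_rel.
Proof.
move=> x y; rewrite /strong_rel eq_sym (eq_sym x.1) (eq_sym x.2).
by rewrite (edge_sym x.1) (edge_sym x.2).
Qed.

Lemma strong_rel_irr : irreflexive strong_rel.
Proof. by move=> x; rewrite /strong_rel eqxx. Qed.

Definition strong_product := SGraph strong_rel_sym strong_rel_irr.

End StrongProduct.

Section Path.
Variable k : nat.

Definition path_rel : rel 'I_k.+1 := fun i j =>
  (i.+1 == j :> nat) || (j.+1 == i :> nat).

Lemma path_rel_sym : symmetric path_rel.
Proof. by move=> i j; rewrite /path_rel orbC. Qed.

Lemma path_rel_irr : irreflexive path_rel.
Proof. by move=> i; rewrite /path_rel orbb gtn_eqF. Qed.

(* [k] is the number of edges. *)
Definition path_graph := SGraph path_rel_sym path_rel_irr.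

End Path.

Definition connected_graph (G : sgraph) : Prop :=
  (0 < #|G|)%N /\ forall x y : G, connect (@edge G) x y.

(* [[:: x; y]] with [edge x y] is a [ucycle], hence the bound on the size. *)
Definition acyclic (G : sgraph) : Prop :=
  forall c : seq G, ucycle (@edge G) c -> (size c <= 2)%N.

Definition is_tree (G : sgraph) : Prop := connected_graph G /\ acyclic G.

Definition tree_decomposition (G T : sgraph) (B : T -> {set G}) : Prop :=
  [/\ is_tree T,
      forall v : G, exists t, v \in B t,
      forall u v : G, edge u v -> exists t, (u \in B t) && (v \in B t) &
      forall (v : G) (s t : T), v \in B s -> v \in B t ->
        connect [rel x y | [&& edge x y, v \in B x & v \in B y]] s t].

(* The width of a tree-decomposition is its largest bag size minus 1. *)
Definition treewidth_le (G : sgraph) (w : nat) : Prop :=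
  exists (T : sgraph) (B : T -> {set G}),
    tree_decomposition B /\ forall t, (#|B t| <= w.+1)%N.

Definition admits_product_structure (C : sgraph -> Prop) : Prop :=
  exists w : nat, forall G : sgraph, C G ->
    exists (H : sgraph) (k : nat),
      treewidth_le H w /\ subgraph G (strong_product H (path_graph k)).

Section Plane.
Variable R : realType.
Implicit Types (S : set (R * R)) (c : R * R) (r theta alpha : R).

Definition area S : \bar R :=
  ((@lebesgue_measure R) \x (@lebesgue_measure R))%E S.

(* [R^o] carries the module structure of [R] over itself. *)
Definition convex_hull S : set (R * R) :=
  smallest (fun A : set (R^o * R^o) => convex_set A) S.

(* The [k]-th corner of the regular [N]-gon with centre [c], circumradius [r]
   and phase [theta]; corners are indexed modulo [N]. *)
Definition corner (N : nat) c r theta (k : nat) : R * R :=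
  (c.1 + r * cos (theta + pi *+ 2 * k%:R / N%:R),
   c.2 + r * sin (theta + pi *+ 2 * k%:R / N%:R)).

(* The convex hull of the [m] consecutive corners starting at phase [theta];
   any other starting corner amounts to another value of [theta]. *)
Definition corner_hull (N m : nat) c r theta : set (R * R) :=
  convex_hull [set corner N c r theta k | k in `I_m].

Definition regular_polygon (N : nat) c r theta : set (R * R) :=
  corner_hull N N c r theta.

Definition homothetic_copy S S' : Prop :=
  exists (s : R) (b : R * R), 0 < s /\
    S' = [set (s * p.1 + b.1, s * p.2 + b.2) | p in S].

Definition alpha_free (V : finType) alpha (F : V -> set (R * R)) : Prop :=
  forall v : V, (alpha%:E * area (F v) <=
    area (F v `\` \bigcup_(u in [set u | u != v]) F u))%E.

Definition intersection_graph (G : sgraph) (F : G -> set (R * R)) : Prop :=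
  forall u v : G, edge u v <-> u != v /\ F u `&` F v !=set0.

Definition free_intersection_class S alpha (G : sgraph) : Prop :=
  exists F : G -> set (R * R),
    [/\ forall v, homothetic_copy S (F v), alpha_free alpha F &
        intersection_graph F].

End Plane.

(* Main.v *)
Require Import Defs.
From mathcomp Require Import all_boot all_order all_algebra.
From mathcomp Require Import all_classical all_reals all_analysis.
From mathcomp Require Import measurable_realfun.
From mathcomp Require Import ring lra zify.

Set Implicit Arguments.
Unset Strict Implicit.
Unset Printing Implicit Defensive.

Import Order.TTheory GRing.Theory Num.Theory.

Local Open Scope classical_set_scope.
Local Open Scope ring_scope.

(* For every [g] there are intersection graphs in which every vertex is within distance
   [rho < 2 * G] of a fixed one and in which [q = G * g] sets of vertices are connected,
   pairwise disjoint and pairwise adjacent. In a product of [H] with a path such a graph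
   lives on [2 * rho + 1] layers; the projections of the sets to [H] are connected and
   pairwise adjacent, so by the Helly property of subtrees some bag of a
   tree-decomposition of [H] meets all of them, and [q <= w.+1 * (2 * rho + 1)]. This
   fails for [g > 4 * w.+1].

   The polygon is the unit ball of a norm [N]. In affine coordinates in which two
   consecutive sides lie on x = -1 and y = -1, the balls are arranged as follows. Hubs,
   that is, balls of radius [S], form [q] columns of height [G + 1], all touching one huge
   ball. At the corner where two consecutive hubs of a column meet, [g] pairs of balls
   [A], [B] of rapidly growing radii slip through, which makes [g] wires cross every
   column there; the pieces in neighbouring columns are joined by chains of tiny balls,
   one vertical and one of small slope. A set is a column together with a wire.

   Only [A] and [B] overlap other balls substantially. What remains of them contains
   nearly the hull of four corners, which is the part of the polygon cut off by the line
   y = sigma - 1; hence the bound on [alpha]. *)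

(** * Graphs of bounded radius in a product with a path *)

(** Balls that merely touch have essentially planar contact graphs, and planar graphs admit product
    structure. Columns and wires therefore have to cross, and a crossing is paid for by overlap.
    With the meeting corner of two hubs as origin, the upper hub locally fills the first quadrant
    and the lower one the third. [A] and [B] of one wire share the point [(q i, q i)] inside the
    upper hub: [A] hangs to the right of it and dips below the hub, [B] rises and leaves the hub to
    the left. All that [A] loses lies above height [0], and since [q i = eta * s i] is tiny compared
    with [s i], this is barely more than what lies above its corner [(q i, q i)]. The growth
    [4 * s i <= eta * s j] puts the smaller [A] to the left of the larger one and the smaller [B]
    below the larger one, so one corner serves [g] wires. The parameters are chosen in the order
    [w], [g], scales, [S], [m], [X], [K], [G]. Only [K] governs the length of the connections
    between columns; it is fixed before [G], so taking [G] beyond [2 * K] keeps the radius below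
    [2 * G] while the number of sets is [G * g]. *)

Lemma tree_edge_bridge (T : sgraph) (x y : T) : acyclic T -> edge x y ->
  ~~ connect [rel u v | edge u v && ((u, v) != (x, y)) && ((u, v) != (y, x))]
       x y.
Proof.
move=> acT exy; apply/negP => /connectP [p0 pth lst].
case/shortenP: pth lst => p pth unq _ lst.
have pth' : path (@edge T) x p.
  by apply: sub_path pth => u v /= /andP[/andP[]].
have := acT (x :: p); rewrite /ucycle /cycle => /(_ _) H.
have {H} : (size (x :: p) <= 2)%N.
  apply: H; apply/andP; split => //.
  by rewrite rcons_path pth' -lst edge_sym.
(* Size at most 2 leaves [p] empty, which makes [x = y], or a single step from [x] to [y], which is
   the removed edge. *)
case: p pth {pth' unq} lst => [|a [|b p]] //=.
  by move=> _ eyx; rewrite eyx edge_irr in exy.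
by move=> + eya; rewrite -eya eqxx /= andbF.
Qed.

(* Following [f] from any point runs into a cycle of [f]; acyclicity leaves only
   cycles of length 2. *)
Lemma tree_step_back (T : sgraph) (f : T -> T) (x0 : T) : acyclic T ->
  (forall x, edge x (f x)) -> exists x, f (f x) = x.
Proof.
move=> acT fe.
have /trajectP [m m_lt def_m] := looping_order f x0.
pose n := order f x0; pose x := iter m f x0.
have xn : iter (n - m) f x = x.
  by rewrite /x -iterD subnK //; apply: ltnW.
have unq : uniq (traject f x (n - m)).
  have := orbit_uniq f x0.
  have -> : orbit f x0 = traject f x0 (m + (n - m)) by rewrite subnKC // ltnW.
  by rewrite trajectD cat_uniq => /and3P[].
have nm0 : (0 < n - m)%N by rewrite subn_gt0.
have : (size (traject f x (n - m)) <= 2)%N.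
  apply: acT; apply/andP; split => //.
  case E : (n - m)%N nm0 => [//|l] _.
  rewrite trajectS /cycle rcons_path.
  have pth : path (@edge T) x (traject f (f x) l).
    elim: l x {E xn unq} => //= l IH x; rewrite fe /=; exact: IH.
  rewrite pth /= last_traject -[X in edge _ X]xn E; exact: fe.
rewrite size_traject; case E : (n - m)%N nm0 => [|[|[|l]]] // _ _.
- by move: xn; rewrite E /= => xn; have := fe x; rewrite xn edge_irr.
- by exists x; move: xn; rewrite E.
Qed.

Definition connected_in (T : sgraph) (S : {pred T}) : Prop :=
  {in S &, forall x y,
    connect [rel u v | [&& edge u v, u \in S & v \in S]] x y}.

(** If every node is missed by some set, let each node point to its neighbour in the direction of
    such a set, which lies in one component of the tree without that node. Some two adjacent nodes
    then point at each other, and the two sets chosen for them lie on opposite sides of their edge,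
    so they cannot meet. *)
Lemma tree_helly (T : sgraph) (q : nat) (S : 'I_q -> {set T}) : is_tree T ->
  (forall i, connected_in (mem (S i))) ->
  (forall i j, exists x, (x \in S i) && (x \in S j)) ->
  exists x, forall i, x \in S i.
Proof.
move=> [[cT conT] acT] conS meetS.
apply: contrapT => nex.
have miss x : exists i, x \notin S i.
  apply: contrapT => h; apply: nex; exists x => i.
  by apply: contrapT => /negP nx; apply: h; exists i.
have stp x : exists yi : T * 'I_q, [/\ edge x yi.1, x \notin S yi.2 &
    forall z, z \in S yi.2 ->
    connect [rel u v | [&& edge u v, u != x & v != x]] yi.1 z].
  have [i xi] := miss x.
  have [s /andP[si _]] := meetS i i.
  have xs : x != s by apply: contraNneq xi => ->.
  have /connectP [p0 pth lst] := conT x s.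
  case/shortenP: pth lst => -[|y p] //=.
    by move=> _ _ _ sx; rewrite sx eqxx in xs.
  rewrite inE negb_or => /andP[exy pth] /andP[/andP[xy xp] _] _ lst.
  exists (y, i); split => // z zi.
  apply: (@connect_trans _ _ s).
    apply/connectP; exists p => //; rewrite /= in xp *.
    elim: p y {exy lst zi} xy xp pth => //= a p IH y xy.
    rewrite inE negb_or => /andP[xa xp] /andP[eya pth].
    by rewrite eya eq_sym xy eq_sym xa /=; apply: IH.
  have := conS i s z si zi; apply: connect_sub => u v /= /and3P[euv ui vi].
  apply: connect1; rewrite /= euv /=; apply/andP; split.
    by apply: contraNneq xi => <-.
  by apply: contraNneq xi => <-.
pose F x := projT1 (cid (stp x)).
have FP x : [/\ edge x (F x).1, x \notin S (F x).2 & forall z, z \in S (F x).2 ->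
    connect [rel u v | [&& edge u v, u != x & v != x]] (F x).1 z].
  exact: projT2 (cid (stp x)).
have [x0 _] : exists x0 : T, true by case/card_gt0P: cT => x0; exists x0.
have Fe x : edge x (F x).1 by case: (FP x).
have [x fx] := @tree_step_back T (fun x => (F x).1) x0 acT Fe.
set y := (F x).1 in fx.
have [exy _ Sx] := FP x; have [_ _ Sy] := FP y.
have [z /andP[z1 z2]] := meetS (F x).2 (F y).2.
have := tree_edge_bridge acT exy; rewrite -/y => /negP; apply.
set e := [rel u v | _].
have e_sym : symmetric e.
  move=> u v /=; rewrite edge_sym -!andbA; congr (_ && _).
  rewrite !xpair_eqE.
  by case: (u == x); case: (v == y); case: (u == y); case: (v == x).
have c1 : connect e y z.
  apply: connect_sub (Sx _ z1) => u v /= /and3P[euv ux vx].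
  by apply: connect1; rewrite /= euv /= !xpair_eqE (negbTE ux) (negbTE vx) ?andbF.
have c2 : connect e x z.
  move: (Sy _ z2); rewrite fx.
  apply: connect_sub => u v /= /and3P[euv uy vy].
  by apply: connect1; rewrite /= euv /= !xpair_eqE (negbTE uy) (negbTE vy) ?andbF.
by rewrite (connect_trans c2) // (sym_connect_sym e_sym).
Qed.

(** Connectedness of [Y i] takes the form of an induction principle from [root i], and the distance
    bound that of a bound for every function [lam] that changes by at most 1 along edges: the layer
    of a vertex in the product is such a function. *)
Lemma product_order_bound (G H : sgraph) (k w q rho : nat) (D : G)
    (Y : 'I_q -> G -> Prop) (root : 'I_q -> G) :
  treewidth_le H w -> subgraph G (strong_product H (path_graph k)) ->
  (forall i, Y i (root i)) ->
  (forall i (Q : G -> Prop), Q (root i) ->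
     (forall u v, Y i u -> Y i v -> edge u v -> Q u -> Q v) ->
     forall v, Y i v -> Q v) ->
  (forall i j, i != j -> exists u v, [/\ Y i u, Y j v & edge u v]) ->
  (forall i j v, Y i v -> Y j v -> i = j) ->
  (forall lam : G -> nat,
     (forall u v, edge u v -> (lam u <= (lam v).+1)%N) ->
     forall i v, Y i v -> (lam v <= lam D + rho)%N && (lam D <= lam v + rho)%N) ->
  (q <= w.+1 * (rho.*2.+1))%N.
Proof.
move=> [T [B [[trT cov adjB conB] wid]]] [f [f_inj f_edge]] Yroot Yind Ymeet Ydis Ydist.
pose p1 v := (f v).1; pose p2 v : nat := (f v).2.
have fe u v : edge u v -> (p1 u == p1 v) || edge (p1 u) (p1 v).
  by move=> /f_edge /and3P[].
have ev u v : edge u v -> exists t, (p1 u \in B t) && (p1 v \in B t).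
  move=> /fe /orP[/eqP->|]; last exact: adjB.
  by have [t tv] := cov (p1 v); exists t; rewrite tv.
pose S i : {set T} := finset (fun x => `[< exists v, Y i v /\ p1 v \in B x >]).
have inS i x v : Y i v -> p1 v \in B x -> x \in S i.
  by move=> Yv vx; rewrite finset.in_set; apply/asboolP; exists v.
have conn1 i v x y : Y i v -> p1 v \in B x -> p1 v \in B y ->
    connect [rel u v | [&& edge u v, u \in S i & v \in S i]] x y.
  move=> Yv vx vy; apply: connect_sub (conB _ _ _ vx vy) => a b /= /and3P[eab ax bx].
  by apply: connect1; rewrite /= eab !(inS i _ v).
have conS i : connected_in (mem (S i)).
  have [x0 x0r] := cov (p1 (root i)).
  have toroot : forall v, Y i v -> forall x, p1 v \in B x ->
      connect [rel u v | [&& edge u v, u \in S i & v \in S i]] x0 x.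
    apply: (Yind i (fun v => forall x, p1 v \in B x -> connect _ x0 x)) => [x|u v Yu Yv euv IH x vx].
      exact: conn1.
    have [t /andP[ut vt]] := ev _ _ euv.
    by apply: connect_trans (IH t ut) _; apply: conn1 vx.
  move=> x y; rewrite /= !finset.in_set => /asboolP[u [Yu ux]] /asboolP[v [Yv vy]].
  apply: (@connect_trans _ _ x0); last exact: toroot vy.
  rewrite sym_connect_sym; first exact: toroot ux.
  by move=> a b /=; rewrite edge_sym; congr (_ && _); rewrite andbC.
have meetS i j : exists x, (x \in S i) && (x \in S j).
  have [<-|ij] := eqVneq i j.
    by have [x xr] := cov (p1 (root i)); exists x; rewrite !(inS i _ _ (Yroot i) xr).
  have [u [v [Yu Yv euv]]] := Ymeet _ _ ij.
  by have [t /andP[ut vt]] := ev _ _ euv; exists t; rewrite (inS i _ u) // (inS j _ v).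
have [x xS] := tree_helly trT conS meetS.
have pick i : {v | Y i v /\ p1 v \in B x}.
  by apply: cid; have := xS i; rewrite finset.in_set => /asboolP.
pose y i := projT1 (pick i).
have Yy i : Y i (y i) by have [] := projT2 (pick i).
have yB i : p1 (y i) \in B x by have [] := projT2 (pick i).
have y_inj : injective y.
  by move=> i j yij; apply: (Ydis i j (y i)) => //; rewrite yij.
have lip u v : edge u v -> (p2 u <= (p2 v).+1)%N.
  move=> /f_edge /and3P[_ _]; rewrite /p2 /= /path_rel => /orP[/eqP->//|].
  by case/orP => /eqP <- //; rewrite ltnW.
have rng i : (p2 (y i) + rho - p2 D < rho.*2.+1)%N.
  have /andP[h1 h2] := Ydist p2 lip i (y i) (Yy i).
  lia.
(* A vertex is determined by its projection, here in the common bag, and its layer. The lower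
   distance bound keeps the subtraction in the second component from being truncated. *)
pose g i : ({z : H | z \in B x} * 'I_(rho.*2.+1))%type :=
  (exist _ (p1 (y i)) (yB i), Ordinal (rng i)).
have g_inj : injective g.
  move=> i j [] p1e p2e; apply: y_inj; apply: f_inj.
  have /andP[_ h1] := Ydist p2 lip i (y i) (Yy i).
  have /andP[_ h2] := Ydist p2 lip j (y j) (Yy j).
  move: p1e p2e h1 h2; rewrite /p1 /p2; case: (f (y i)) => a1 a2; case: (f (y j)) => b1 b2 /= -> e h1 h2.
  congr (_, _); apply: ord_inj; lia.
have := leq_card g g_inj; rewrite card_ord card_prod card_ord card_sig.
move=> /leq_trans; apply; rewrite leq_mul2r; apply/orP; right.
by have := wid x; rewrite cardE.
Qed.

(** * The arrangement of balls *)

Section Chain.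
Variables (R : realFieldType) (r d : R) (K : nat).
Hypotheses (r_gt0 : 0 < r) (rd : 2 * r < d) (K_gt0 : (0 < K)%N).

(** Balls [0] and [K.+1] sit at the ends of a segment of length [d] and keep the radius [r], so
    their contacts with other balls do not depend on [K]; the [K] equal balls between them fill the
    rest, each touching the next. *)
Definition chain_radius (t : nat) : R :=
  if (t == 0%N) || (t == K.+1) then r else (d - 2 * r) / (2 * K%:R).

Definition chain_pos (t : nat) : R :=
  if t == 0%N then 0 else
  if (t <= K)%N then r + (2 * t%:R - 1) * ((d - 2 * r) / (2 * K%:R)) else d.

Let e := (d - 2 * r) / (2 * K%:R).

Let e_gt0 : 0 < e.
Proof. by rewrite divr_gt0 ?subr_gt0 // mulr_gt0 // ltr0n. Qed.

Let d_e : d = 2 * r + 2 * K%:R * e.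
Proof.
have K0 : K%:R != 0 :> R by rewrite pnatr_eq0 -lt0n.
by rewrite /e; field.
Qed.

Lemma chain_radius_gt0 t : 0 < chain_radius t.
Proof. by rewrite /chain_radius; case: ifP => // _; exact: e_gt0. Qed.

Lemma chain_radius_le t : e <= r -> chain_radius t <= r.
Proof. by rewrite /chain_radius; case: ifP. Qed.

Lemma chain_sep t t' : (t < t')%N -> (t' <= K.+1)%N ->
  chain_radius t + chain_radius t' <= chain_pos t' - chain_pos t.
Proof.
have e0 := ltW e_gt0.
move=> tt' t'K; rewrite /chain_radius /chain_pos -/e.
have -> : (t == K.+1) = false by apply/negbTE; lia.
have -> : (t' == 0%N) = false by apply/negbTE; lia.
rewrite orbF /=; have -> : (t <= K)%N by lia.
have t'1 : 1 <= t'%:R :> R by rewrite ler1n; lia.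
have [->|t'K1] := eqVneq t' K.+1.
  rewrite ltnn; case: eqP => [_|/eqP t0] /=; first (rewrite ?subr0; move: rd; lra).
  have h : 0 <= (K%:R - t%:R) * e by rewrite mulr_ge0 // subr_ge0 ler_nat; lia.
  by rewrite d_e; lra.
have -> : (t' <= K)%N by lia.
case: eqP => [t0|/eqP t0].
  have h : 0 <= (t'%:R - 1) * e by rewrite mulr_ge0 // subr_ge0.
  by rewrite subr0; lra.
have tt1 : t%:R + 1 <= t'%:R :> R by rewrite natr1 ler_nat.
have h : 0 <= (t'%:R - t%:R - 1) * e by rewrite mulr_ge0 //; lra.
by lra.
Qed.

Lemma chain_touch t : (t <= K)%N ->
  chain_pos t.+1 - chain_pos t = chain_radius t + chain_radius t.+1.
Proof.
move=> tK; rewrite /chain_radius /chain_pos -/e eqSS /=.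
have -> : (t == K.+1) = false by apply/negbTE; lia.
rewrite orbF tK -natr1.
have [tK'|tK'] := ltnP t K.
  have -> : (t == K) = false by apply/negbTE; lia.
  case: eqP => [->|_]; rewrite ?add0r; lra.
have -> : t = K by lia.
rewrite eqxx; have -> : (K == 0%N) = false by apply/negbTE; lia.
by rewrite d_e; lra.
Qed.

Lemma chain_pos0 : chain_pos 0 = 0. Proof. by []. Qed.

Lemma chain_posK : chain_pos K.+1 = d.
Proof. by rewrite /chain_pos ltnn. Qed.

Lemma chain_pos_ge t : (0 < t <= K.+1)%N -> r + chain_radius t <= chain_pos t.
Proof.
move=> /andP[t0 tK]; have := chain_sep t0 tK.
by rewrite chain_pos0 subr0 {1}/chain_radius.
Qed.

Lemma chain_pos_ge0 t : (t <= K.+1)%N -> 0 <= chain_pos t.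
Proof.
case: t => [|t] tK; first by rewrite chain_pos0.
have := @chain_pos_ge t.+1 tK; have := chain_radius_gt0 t.+1.
by move: r_gt0 => h0 h1 h2; lra.
Qed.

Lemma chain_pos_le t : (t <= K.+1)%N -> chain_pos t <= d.
Proof.
rewrite leq_eqVlt => /orP[/eqP->|tK]; first by rewrite chain_posK.
have := chain_sep tK (leqnn _); rewrite chain_posK.
by have := chain_radius_gt0 t; have := chain_radius_gt0 K.+1; lra.
Qed.

End Chain.

(** * Separation by lines, and the scales of the arrangement *)

Section Packing.
Variables (R : realFieldType) (N : R -> R -> R) (sigma eta kap : R).
Hypothesis N_tri : forall x y x' y', N (x + x') (y + y') <= N x y + N x' y'.
Hypothesis N_hom : forall t x y, N (t * x) (t * y) = `|t| * N x y.
Hypothesis N_x : forall x y, `|x| <= N x y.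
Hypothesis N_y : forall x y, `|y| <= N x y.
Hypothesis N_diag : N 1 1 <= 1.
Hypothesis N_left : N 1 (1 - sigma) <= 1.
Hypothesis N_bot : N (1 - sigma) 1 <= 1.
Hypothesis sigma_bnd : 0 < sigma <= 2.
Hypothesis eta_bnd : [/\ 0 < eta, eta <= 1 / 2, eta <= sigma / 2 & eta < kap].
Hypothesis kap_le1 : kap <= 1.

(** The inequality is weak: separated balls may touch, and most edges of the graph are such
    contacts. *)
Definition sep (x y r x' y' r' : R) := r + r' <= N (x - x') (y - y').

Lemma N_opp x y : N (- x) (- y) = N x y.
Proof. by rewrite -[- x]mulN1r -[- y]mulN1r N_hom normrN1 mul1r. Qed.

Lemma sep_sym x y r x' y' r' : sep x y r x' y' r' -> sep x' y' r' x y r.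
Proof. by rewrite /sep -[x' - x]opprB -[y' - y]opprB N_opp addrC. Qed.

Lemma sep_x x y r x' y' r' : x + r <= x' - r' -> sep x y r x' y' r'.
Proof.
move=> h; apply: le_trans (N_x _ _); rewrite distrC.
by apply: le_trans (ler_norm _); lra.
Qed.

Lemma sep_y x y r x' y' r' : y + r <= y' - r' -> sep x y r x' y' r'.
Proof.
move=> h; apply: le_trans (N_y _ _); rewrite distrC.
by apply: le_trans (ler_norm _); lra.
Qed.

(** The linear form [y - m * x] is at most [(1 + m) * N x y], so this margin on both sides lets a
    line of slope [m] separate the balls. *)
Lemma sep_slope m x y r x' y' r' : 0 <= m ->
  y - m * x + (1 + m) * r <= y' - m * x' - (1 + m) * r' -> sep x y r x' y' r'.
Proof.
move=> m0 h; apply: sep_sym; rewrite /sep.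
set n := N _ _.
have h1 : x - x' <= n by apply: le_trans (N_x _ _); rewrite distrC ler_norm.
have h2 : y' - y <= n by apply: le_trans (N_y _ _); rewrite ler_norm.
have h3 : m * (x - x') <= m * n by rewrite ler_wpM2l.
have : (1 + m) * (r' + r) <= (1 + m) * n by lra.
by rewrite ler_pM2l //; lra.
Qed.

Variables (s : nat -> R) (g : nat) (W S m X : R).
Hypothesis s_ge1 : forall i, 1 <= s i.
Hypothesis s_inc : forall i j, (i < j)%N -> 4 * s i <= eta * s j.
Hypothesis s_le : forall i, (i < g)%N -> s i <= W.
Hypothesis W_ge1 : 1 <= W.
Hypothesis S_big : 64 * W <= kap * S.
Hypothesis mS : m * S = eta / 16.
Hypothesis mX : m * X = 32 * W.

(** [r0] is the radius of the end balls of all chains. A ball of this radius at [(xw i, y0 i)]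
    touches the lower left corner of [A] with its upper right corner. The depth [dd i] is such that
    the line of slope [m] from [(xw i, - dd i)] is at height [xw i] after the horizontal distance
    [X - sigma * s i], where such a ball touches the lower left corner of the next [B]. *)
Definition r0 := eta / 8.
Definition q i := eta * s i.
Definition xw i := q i - r0.
Definition y0 i := q i - sigma * s i - r0.
Definition dd i := 32 * W - m * (sigma * s i) - xw i.

Lemma S_ge : 64 * W <= S.
Proof.
have [e0 _ _ ek] := eta_bnd.
apply: le_trans S_big _; rewrite -[leRHS]mul1r ler_wpM2r ?kap_le1 //.
have : 0 < kap * S by apply: lt_le_trans S_big; move: W_ge1; lra.
by rewrite pmulr_rgt0 ?(lt_trans e0 ek) // => /ltW.
Qed.

(** By [mS] a sloped chain rises only by [r0] across the width [2 * S] of a hub, while by [mX] it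
    rises from below every [A] to the level of the next [B]. *)
Lemma m_bnd : [/\ 0 < m, m * W <= eta / 1024 & m <= 1 / 1024].
Proof.
have [e0 e1 _ _] := eta_bnd; have SW := S_ge.
have S0 : 0 < S by move: W_ge1; lra.
have m0 : 0 < m by rewrite -(pmulr_lgt0 _ S0) mS divr_gt0.
have h : m * (64 * W) <= m * S by rewrite ler_wpM2l // ltW.
have h' : m * 1 <= m * W by rewrite ler_wpM2l // ltW.
by move: mS h h'; split => //; lra.
Qed.

Lemma X_big : 4 * S + 8 * W <= X.
Proof.
have [m0 mW _] := m_bnd; have [e0 e1 _ _] := eta_bnd.
rewrite -(ler_pM2l m0) mX mulrDr; move: mS mW W_ge1; lra.
Qed.

(* The products are the atoms that [lra] meets below. *)
Lemma scale_bnd i : (i < g)%N ->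
  [/\ 1 <= s i /\ s i <= W, eta <= eta * s i /\ eta * s i <= s i / 2,
      2 * (eta * s i) <= sigma * s i /\ sigma * s i <= 2 * s i &
      0 <= m * (sigma * s i) /\ m * (sigma * s i) <= eta / 512].
Proof.
move=> ig; have [e0 e1 e2 _] := eta_bnd; have /andP[g0 g2] := sigma_bnd.
have [m0 mW _] := m_bnd; have s1 := s_ge1 i; have sW := s_le ig.
have s0 : 0 < s i by apply: lt_le_trans s1.
have h1 : eta * 1 <= eta * s i by rewrite ler_wpM2l // ltW.
have h2 : eta * s i <= 1 / 2 * s i by rewrite ler_wpM2r // ltW.
have h3 : eta * s i <= sigma / 2 * s i by rewrite ler_wpM2r // ltW.
have h4 : sigma * s i <= 2 * s i by rewrite ler_wpM2r // ltW.
have h5 : 0 <= m * (sigma * s i) by rewrite !mulr_ge0 // ltW.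
have h6 : m * (sigma * s i) <= m * (2 * s i) by rewrite ler_wpM2l // ltW.
have h7 : m * s i <= m * W by rewrite ler_wpM2l // ltW.
by clear e1 e2 g0 g2 m0; do 2!split => //; lra.
Qed.

Lemma scale_slope i : (i < g)%N ->
  [/\ 0 <= m * s i, m * s i <= eta / 1024, 0 <= m * (eta * s i),
      m * (eta * s i) <= m * s i / 2 & m * eta <= eta / 1024].
Proof.
move=> ig; have [e0 e1 _ _] := eta_bnd; have [m0 mW m1] := m_bnd.
have s1 := s_ge1 i; have sW := s_le ig.
have s0 : 0 < s i by apply: lt_le_trans s1.
have h1 : m * s i <= m * W by rewrite ler_wpM2l // ltW.
have h2 : m * (eta * s i) <= m * (1 / 2 * s i).
  by rewrite ler_wpM2l ?ler_wpM2r // ltW.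
have h3 : m * eta <= 1 / 1024 * eta by rewrite ler_wpM2r // ltW.
by split; rewrite ?mulr_ge0 ?(ltW e0) ?(ltW m0) ?(ltW s0) //; clear e1 m1; lra.
Qed.

Lemma scale_inc i j : (i < j)%N ->
  [/\ 4 * s i <= eta * s j, sigma * s i - eta * s i <= sigma * s j - eta * s j,
      m * (sigma * s i) <= m * (sigma * s j) &
      m * (eta * s j) - m * (eta * s i) <= (eta * s j - eta * s i) / 1024].
Proof.
move=> ij; have [e0 e1 e2 ek] := eta_bnd; have /andP[g0 g2] := sigma_bnd.
have [m0 mW m1] := m_bnd; have s4 := s_inc ij; have s1 := s_ge1 i.
have sj1 := s_ge1 j.
have sij : s i <= s j.
  have : eta * s j <= 1 / 2 * s j by rewrite ler_wpM2r //; lra.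
  lra.
have h1 : 0 <= (sigma - eta) * (s j - s i) by rewrite mulr_ge0; lra.
have h2 : m * (sigma * s i) <= m * (sigma * s j).
  by rewrite ler_wpM2l ?ler_wpM2l // ltW.
have eij : eta * s i <= eta * s j by rewrite ler_wpM2l // ltW.
have h3 : m * (eta * s j - eta * s i) <= 1 / 1024 * (eta * s j - eta * s i).
  by rewrite ler_wpM2r // subr_ge0.
by split => //; lra.
Qed.

Definition offset (J J' : R) := J + X <= J'.

(** A vertical slab that contains [A] and the vertical chain of wire [i]. The growth of the scales
    keeps the slabs of one column apart, the offset those of different columns. *)
Definition in_col J i x rho := J + q i - 2 * r0 <= x - rho /\ x + rho <= J + q i + 2 * s i.

Lemma sep_col_lt J J' i i' x y rho x' y' rho' : (i < g)%N -> (i' < g)%N ->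
  in_col J i x rho -> in_col J' i' x' rho' ->
  offset J J' \/ J = J' /\ (i < i')%N -> sep x y rho x' y' rho'.
Proof.
move=> ig ig'; rewrite /in_col /offset /r0 /q => -[_ h] [h' _] H; apply: sep_x.
have [e0 _ _ _] := eta_bnd.
have [[? ?] [? ?] _ _] := scale_bnd ig; have [[? ?] [? ?] _ _] := scale_bnd ig'.
case: H => [H|[e ii]]; first by have XX := X_big; have SS := S_ge; lra.
by have [? _ _ _] := scale_inc ii; subst J'; lra.
Qed.

(** * The pieces of wires near the corner of two hubs *)

Section Wires.
Variables (J J' : R) (i i' : nat).
Hypotheses (ig : (i < g)%N) (ig' : (i' < g)%N).

Let bnd := scale_bnd ig.
Let bnd' := scale_bnd ig'.

(* [A] and [B] are balls with centres ([Ax i], [Ay i]) and ([Ay i], [Ax i]);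
   the vertical chain has centres ([xw i], y) and the sloped one
   ([xw i] + u, [- dd i] + m * u), all relative to the corner where two hubs meet. *)
Definition Ax i := q i + s i.
Definition Ay i := q i + s i * (1 - sigma).

Definition in_vert i y rho := [/\ - dd i <= y, y <= y0 i, 0 < rho & rho <= r0].
Definition in_slope i u rho :=
  [/\ 0 <= u, 0 <= m * u, u <= X - sigma * s i,
      m * u <= 32 * W - m * (sigma * s i) & 0 < rho <= r0].

Ltac unf := rewrite /in_vert /in_slope /in_col /offset /Ax /Ay /dd /xw /y0 /q /r0.
Ltac fact1 := have [? ? _ _] := eta_bnd;
  have [[? ?] [? ?] [? ?] [? ?]] := bnd.
Ltac fact2 := fact1; have [[? ?] [? ?] [? ?] [? ?]] := bnd'.
Ltac factX := have ? := X_big; have ? := S_ge.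
Ltac factm := have [? ? ? ? ?] := scale_slope ig.
Ltac factm' := have [? ? ? ? ?] := scale_slope ig'.

Lemma in_col_A : in_col J i (J + Ax i) (s i).
Proof. by unf; fact1; split; lra. Qed.

Lemma in_col_vert y rho : in_vert i y rho -> in_col J i (J + xw i) rho.
Proof. by unf; fact1 => -[*]; split; lra. Qed.

Lemma sep_BB_lt : (i < i')%N \/ i = i' /\ offset J J' ->
  sep (J + Ay i) (Ax i) (s i) (J' + Ay i') (Ax i') (s i').
Proof.
unf; fact1 => -[ii|[e H]].
  by apply: sep_y; have [? _ _ _] := scale_inc ii; lra.
by factX; apply: sep_x; subst i'; lra.
Qed.

Lemma sep_AB_off : offset J J' \/ offset J' J ->
  sep (J + Ax i) (Ay i) (s i) (J' + Ay i') (Ax i') (s i').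
Proof.
unf; factX; fact2 => -[H|H]; first by apply: sep_x; lra.
by apply/sep_sym/sep_x; lra.
Qed.

Lemma sep_A_vert y rho : in_vert i y rho ->
  sep (J + Ax i) (Ay i) (s i) (J + xw i) y rho.
Proof. by unf; fact1 => -[*]; apply/sep_sym/sep_y; lra. Qed.

Lemma sep_B_vert y rho : in_vert i' y rho ->
  sep (J + Ay i) (Ax i) (s i) (J' + xw i') y rho.
Proof. by unf; fact2 => -[*]; apply/sep_sym/sep_y; lra. Qed.

Let m0 : 0 <= m. Proof. by have [/ltW] := m_bnd. Qed.

Lemma m_radius rho : rho <= r0 -> m * rho <= m * eta / 8.
Proof. by move=> h; rewrite -mulrA ler_wpM2l. Qed.

(** A sloped chain starts to the right of the slabs of smaller index, and stops [sigma * s i'] short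
    of the distance [X], hence to the left of the slabs of the next column. *)
Lemma sep_col_slope_off x y rho0 u rho : in_col J i x rho0 -> in_slope i' u rho ->
  [\/ offset J' J, offset J J' | J = J' /\ (i < i')%N] ->
  sep x y rho0 (J' + xw i' + u) (- dd i' + m * u) rho.
Proof.
unf; fact2 => -[? ?] [? _ ? _ /andP[? ?]] [H|H|[H ii]].
- by apply/sep_sym/sep_x; lra.
- by factX; apply/sep_x; lra.
- by have [? _ _ _] := scale_inc ii; subst J'; apply/sep_x; lra.
Qed.

(** Here the chain has to pass beneath [A]: it starts at a depth of about [32 * W], whereas no [A]
    reaches deeper than [2 * W]. *)
Lemma sep_A_slope u rho : in_slope i' u rho -> (i' < i)%N \/ i = i' ->
  sep (J + Ax i) (Ay i) (s i) (J + xw i' + u) (- dd i' + m * u) rho.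
Proof.
move=> [_ _ _ _ /andP[rho0 rhor]] H; apply/sep_sym/(sep_slope m0).
have mrho := m_radius rhor; move: rhor.
have -> : - dd i' + m * u - m * (J + xw i' + u) = - dd i' - m * xw i' - m * J by ring.
by unf; case: H => [ii|e];
  [have [? _ _ _] := scale_inc ii; fact2; factm; factm'|subst i'; fact1; factm] => ?; lra.
Qed.

(** The vertical chain of larger index stops higher, so the sloped chain of smaller index runs
    beneath its lower end. *)
Lemma sep_vert_slope_lt y rho0 u rho : in_vert i y rho0 -> in_slope i' u rho ->
  (i' < i)%N -> sep (J + xw i) y rho0 (J + xw i' + u) (- dd i' + m * u) rho.
Proof.
move=> [yl _ _ rhor0] [_ _ _ _ /andP[_ rhor]] ii; apply/sep_sym/(sep_slope m0).
have mrho := m_radius rhor; have mrho0 := m_radius rhor0.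
move: rhor rhor0 yl; have [? _ ? ?] := scale_inc ii.
have -> : - dd i' + m * u - m * (J + xw i' + u) = - dd i' - m * xw i' - m * J by ring.
have [? ? _ _] := eta_bnd; have s1 := s_ge1 i'.
have ? : eta * s i' <= s i' / 2 by have [[? ?] [? ?] _ _] := scale_bnd ig'.
by unf; factm => *; lra.
Qed.

Lemma sep_vert0_slope rho0 u rho : in_vert i (y0 i) rho0 -> in_slope i u rho ->
  sep (J + xw i) (y0 i) rho0 (J + xw i + u) (- dd i + m * u) rho.
Proof.
move=> [_ _ _ rhor0] [_ _ _ _ /andP[_ rhor]]; apply/sep_sym/(sep_slope m0).
have mrho := m_radius rhor; have mrho0 := m_radius rhor0; move: rhor rhor0.
have -> : - dd i + m * u - m * (J + xw i + u) = - dd i - m * xw i - m * J by ring.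
by unf; fact1; factm => ? ?; lra.
Qed.

(** In the next column the chain ends at the lower left corner of its own [B]; smaller [B] lie to
    the right of the whole chain and larger ones above it. *)
Lemma sep_B_slope u rho : in_slope i' u rho ->
  [\/ J = J' + X, J = J', offset J J' | J' + X + X <= J] ->
  sep (J + Ay i) (Ax i) (s i) (J' + xw i' + u) (- dd i' + m * u) rho.
Proof.
move=> [? ? ? ? /andP[? rhor]] [H|H|H|H].
- subst J; case: (ltngtP i i') => [ii|ii|e].
  + by have [_ ? _ _] := scale_inc ii; apply/sep_sym/sep_x; move: rhor; unf; lra.
  + have [? _ _ _] := scale_inc ii; apply/sep_sym/sep_y.
    by move: rhor; unf; fact2; lra.
  + by subst i'; apply/sep_sym/sep_x; move: rhor; unf; lra.
- subst J'; apply/sep_sym/(sep_slope m0); have mrho := m_radius rhor.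
  have -> : - dd i' + m * u - m * (J + xw i' + u) = - dd i' - m * xw i' - m * J by ring.
  by move: rhor; unf; fact2; factm; factm' => ?; lra.
- by apply/sep_x; move: rhor H; unf; factX; fact2; lra.
- by apply/sep_sym/sep_x; move: rhor H; unf; factX; fact2; lra.
Qed.

(** Within a column the sloped chains follow parallel lines, the larger index on top, and the gap is
    far more than [2 * r0]. *)
Lemma sep_slope_slope u rho u' rho' : in_slope i u rho -> in_slope i' u' rho' ->
  offset J J' \/ J = J' /\ (i < i')%N ->
  sep (J + xw i + u) (- dd i + m * u) rho (J' + xw i' + u') (- dd i' + m * u') rho'.
Proof.
move=> [? ? ? ? /andP[? rhor]] [? ? ? ? /andP[? rhor']] [H|[H ii]].
  by apply/sep_x; move: rhor rhor' H; unf; factX; fact2; lra.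
subst J'; apply/(sep_slope m0).
have mrho := m_radius rhor; have mrho0 := m_radius rhor'.
have -> : - dd i + m * u - m * (J + xw i + u) = - dd i - m * xw i - m * J by ring.
have -> : - dd i' + m * u' - m * (J + xw i' + u') = - dd i' - m * xw i' - m * J by ring.
have [? _ ? ?] := scale_inc ii; have s1 := s_ge1 i; have [? ? _ _] := eta_bnd.
have [_ [_ ?] _ _] := bnd; have [_ _ _ _ ?] := scale_slope ig.
by move: rhor rhor'; unf => ? ?; lra.
Qed.

(* The upper right hubs have centres [J + S, S] and the lower left ones
   [J - S, - S]. *)
Lemma sep_A_up : offset J J' \/ offset J' J ->
  sep (J + Ax i) (Ay i) (s i) (J' + S) S S.
Proof. by unf; fact1; factX => -[H|H]; [|apply/sep_sym]; apply/sep_x; lra. Qed.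

Lemma sep_A_low : [\/ J = J', offset J J' | offset J' J] ->
  sep (J + Ax i) (Ay i) (s i) (J' - S) (- S) S.
Proof.
by unf; fact1; factX => -[H|H|H]; [apply/sep_sym| |apply/sep_sym]; apply/sep_x; lra.
Qed.

Lemma sep_B_up : offset J J' \/ offset J' J ->
  sep (J + Ay i) (Ax i) (s i) (J' + S) S S.
Proof. by unf; fact1; factX => -[H|H]; [|apply/sep_sym]; apply/sep_x; lra. Qed.

Lemma sep_B_low : sep (J + Ay i) (Ax i) (s i) (J' - S) (- S) S.
Proof. by unf; fact1; apply/sep_sym/sep_y; lra. Qed.

Lemma sep_vert_up y rho : in_vert i y rho -> sep (J + xw i) y rho (J' + S) S S.
Proof. by unf; fact1 => -[*]; apply/sep_y; lra. Qed.

Lemma sep_vert_low y rho : in_vert i y rho ->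
  [\/ J = J', offset J J' | offset J' J] -> sep (J + xw i) y rho (J' - S) (- S) S.
Proof.
unf; fact1; factX.
by move=> -[? ? ? ?] [H|H|H]; [apply/sep_sym| |apply/sep_sym]; apply/sep_x; lra.
Qed.

Lemma sep_slope_up u rho : in_slope i u rho ->
  [\/ J = J', offset J J' | offset J' J] ->
  sep (J + xw i + u) (- dd i + m * u) rho (J' + S) S S.
Proof.
move=> [? ? ? ? /andP[? rhor]] [H|H|H].
- subst J'; apply/(sep_slope m0); move: mS => ?; have mrho := m_radius rhor.
  have -> : - dd i + m * u - m * (J + xw i + u) = - dd i - m * xw i - m * J by ring.
  by move: rhor; unf; fact1; factm => ?; lra.
- by apply/sep_x; move: rhor H; unf; factX; fact1; lra.
- by apply/sep_sym/sep_x; move: rhor H; unf; factX; fact1; lra.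
Qed.

(** Over the lower hub of the next column the chain is already within [2 * m * S = r0] of its final
    height [xw i], so it clears the top of the hub by more than its radius. *)
Lemma sep_slope_low u rho : in_slope i u rho ->
  [\/ J = J', J + X = J', J + X + X <= J' | offset J' J] ->
  sep (J + xw i + u) (- dd i + m * u) rho (J' - S) (- S) S.
Proof.
move=> [? ? ? ? /andP[? rhor]] [H|H|H|H].
- by subst J'; apply/sep_sym/sep_x; move: rhor; unf; factX; fact1; lra.
- subst J'; apply/sep_sym/(sep_slope m0); move: mS mX => ? ?.
  have mrho := m_radius rhor.
  have -> : - dd i + m * u - m * (J + xw i + u) = - dd i - m * xw i - m * J by ring.
  by move: rhor; unf; fact1; factm => ?; lra.
- by apply/sep_x; move: rhor H; unf; factX; fact1; lra.
- by apply/sep_sym/sep_x; move: rhor H; unf; factX; fact1; lra.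
Qed.

Lemma band_A : - S <= Ay i - s i /\ Ay i + s i <= S.
Proof. by unf; fact1; have ? := S_ge; split; lra. Qed.

Lemma band_B : - S <= Ax i - s i /\ Ax i + s i <= S.
Proof. by unf; fact1; have ? := S_ge; split; lra. Qed.

Lemma band_vert y rho : in_vert i y rho -> - S <= y - rho /\ y + rho <= S.
Proof. by unf; fact1; have ? := S_ge => -[*]; split; lra. Qed.

Lemma band_slope u rho : in_slope i u rho ->
  - S <= - dd i + m * u - rho /\ - dd i + m * u + rho <= S.
Proof. by unf; fact1; have ? := S_ge => -[? ? ? ? /andP[*]]; split; lra. Qed.

(** Shrinking a hub by the factor [1 - kap] frees a margin [kap * S >= 64 * W] at its corner, far
    more than the size of any [A]. *)
Lemma hub_A_core : (1 - kap) * S + s i < N (J + S - (J + Ax i)) (S - Ay i).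
Proof.
unf; fact1; apply: lt_le_trans (N_y _ _); apply: lt_le_trans (ler_norm _).
by move: S_big => ?; lra.
Qed.

Lemma hub_B_core : (1 - kap) * S + s i < N (J + S - (J + Ay i)) (S - Ax i).
Proof.
unf; fact1; apply: lt_le_trans (N_x _ _); apply: lt_le_trans (ler_norm _).
by move: S_big => ?; lra.
Qed.

(* The core of [A] lies below the line [y = Ay i + (sigma - 1 - kap) * s i]. *)
Lemma A_core_low : Ay i + (sigma - 1 - kap) * s i < 0.
Proof.
have [_ _ _ ek] := eta_bnd; have s1 := s_ge1 i.
have : eta * s i < kap * s i by rewrite ltr_pM2r //; lra.
by unf; lra.
Qed.

Lemma A_core_B : Ay i + (sigma - 1 - kap) * s i < Ax i' - s i'.
Proof. by apply: lt_le_trans A_core_low _; unf; fact2; lra. Qed.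

(** The common point is [(q i, q i)]. By [N_left] and [N_bot] the corners next to [(-1, -1)] lie in
    the unit ball; the point is one of them for [A] and the other for [B]. *)
Lemma A_touches_B : N (Ax i - Ay i) (Ay i - Ax i) <= s i + s i.
Proof.
have s0 : 0 <= s i by apply: le_trans (s_ge1 i).
have -> : Ax i - Ay i = s i * 1 + s i * (- (1 - sigma)) by rewrite /Ax /Ay; ring.
have -> : Ay i - Ax i = s i * (1 - sigma) + s i * (- 1) by rewrite /Ax /Ay; ring.
apply: le_trans (N_tri _ _ _ _) _; rewrite !N_hom N_opp (ger0_norm s0).
by apply: lerD; rewrite ger_pMr // (lt_le_trans ltr01 (s_ge1 i)).
Qed.

(** The point [(q i, q i)] serves again: it lies on the diagonal of the hub. *)
Lemma hub_touches_A : N (S - Ax i) (S - Ay i) <= S + s i.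
Proof.
have s0 : 0 <= s i by apply: le_trans (s_ge1 i).
have S0 : 0 <= S - eta * s i by fact1; have ? := S_ge; lra.
have -> : S - Ax i = (S - eta * s i) * 1 + s i * (- 1) by unf; ring.
have -> : S - Ay i = (S - eta * s i) * 1 + s i * (- (1 - sigma)) by unf; ring.
apply: le_trans (N_tri _ _ _ _) _; rewrite !N_hom N_opp !ger0_norm //.
have h1 : (S - eta * s i) * N 1 1 <= (S - eta * s i) * 1 by rewrite ler_wpM2l.
have h2 : s i * N 1 (1 - sigma) <= s i * 1 by rewrite ler_wpM2l.
have h3 : 0 <= eta * s i by fact1; lra.
by lra.
Qed.

Lemma A_touches_vert0 : N (Ax i - xw i) (Ay i - y0 i) <= s i + r0.
Proof.
have [e0 _ _ _] := eta_bnd; have s1 := s_ge1 i.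
have s0 : 0 <= s i + r0 by unf; lra.
have -> : Ax i - xw i = (s i + r0) * 1 by unf; ring.
have -> : Ay i - y0 i = (s i + r0) * 1 by unf; ring.
by rewrite N_hom ger0_norm // -[leRHS]mulr1 ler_wpM2l.
Qed.

Lemma B_touches_slope_end u : u = X - sigma * s i ->
  N (X + Ay i - (xw i + u)) (Ax i - (- dd i + m * u)) <= s i + r0.
Proof.
move=> ->; have -> : - dd i + m * (X - sigma * s i) = xw i.
  by rewrite mulrBr mX /dd; ring.
have [e0 _ _ _] := eta_bnd; have s1 := s_ge1 i.
have s0 : 0 <= s i + r0 by unf; lra.
have -> : X + Ay i - (xw i + (X - sigma * s i)) = (s i + r0) * 1 by unf; ring.
have -> : Ax i - xw i = (s i + r0) * 1 by unf; ring.
by rewrite N_hom ger0_norm // -[leRHS]mulr1 ler_wpM2l.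
Qed.

End Wires.

(** * The chains between neighbouring columns *)

Variable K : nat.
Hypothesis K_gt0 : (0 < K)%N.
Hypothesis K_big : N 1 m * (N 0 1 * (32 * W) + N 1 m * X) <= K%:R * r0.

Definition lv i := N 0 1 * (y0 i + dd i).
Definition ls i := N 1 m * (X - sigma * s i).

Lemma norm_dirs : 1 <= N 0 1 /\ 1 <= N 1 m.
Proof.
split; first by have := N_y 0 1; rewrite normr1.
by have := N_x 1 m; rewrite normr1.
Qed.

Lemma r0_gt0 : 0 < r0.
Proof. by have [e0 _ _ _] := eta_bnd; rewrite /r0 divr_gt0. Qed.

Lemma y0_dd i : y0 i + dd i = 32 * W - sigma * s i - m * (sigma * s i).
Proof. by rewrite /y0 /dd /xw; ring. Qed.

Lemma lv_gt i : (i < g)%N -> 2 * r0 < lv i.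
Proof.
move=> ig; have [h _] := norm_dirs; have [e0 e1 _ _] := eta_bnd.
have [[? ?] [? ?] [? ?] [? ?]] := scale_bnd ig.
have h1 : 2 * r0 < y0 i + dd i by rewrite y0_dd /r0; lra.
apply: lt_le_trans h1 _; rewrite -[leLHS]mul1r ler_wpM2r // y0_dd; lra.
Qed.

Lemma ls_gt i : (i < g)%N -> 2 * r0 < ls i.
Proof.
move=> ig; have [_ h] := norm_dirs; have [e0 e1 _ _] := eta_bnd.
have [[? ?] [? ?] [? ?] [? ?]] := scale_bnd ig.
have XX := X_big; have SS := S_ge.
have h1 : 2 * r0 < X - sigma * s i by rewrite /r0; lra.
apply: lt_le_trans h1 _; rewrite -[leLHS]mul1r ler_wpM2r //; lra.
Qed.

(** [K] is so large that, at the turn from the vertical to the sloped chain, the inner balls of both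
    fit into the horizontal room [r0 / N 1 m] made by the end ball they share. *)
Lemma link_small i : (i < g)%N ->
  (lv i - 2 * r0) / (2 * K%:R) + (ls i - 2 * r0) / (2 * K%:R) <= r0 / N 1 m.
Proof.
move=> ig; have [h1 h2] := norm_dirs; have r00 := r0_gt0.
have [[? ?] [? ?] [? ?] [? ?]] := scale_bnd ig.
have [e0 _ _ _] := eta_bnd.
have K0 : 0 < K%:R :> R by rewrite ltr0n.
have M0 : 0 < N 1 m by lra.
rewrite -mulrDl ler_pdivrMr ?mulr_gt0 // mulrAC ler_pdivlMr //.
have a1 : lv i <= N 0 1 * (32 * W).
  by rewrite /lv ler_wpM2l ?y0_dd; lra.
have a2 : ls i <= N 1 m * X by rewrite /ls ler_wpM2l; lra.
have a3 : (lv i - 2 * r0 + (ls i - 2 * r0)) * N 1 m <=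
    (N 0 1 * (32 * W) + N 1 m * X) * N 1 m by rewrite ler_wpM2r //; lra.
have a4 : 0 <= r0 * K%:R by rewrite mulr_ge0 // ltW.
by move: K_big; lra.
Qed.

Lemma link_le i : (i < g)%N ->
  (lv i - 2 * r0) / (2 * K%:R) <= r0 /\ (ls i - 2 * r0) / (2 * K%:R) <= r0.
Proof.
move=> ig; have := link_small ig; have [_ h] := norm_dirs.
have r00 := r0_gt0.
have h1 : r0 / N 1 m <= r0 by rewrite ler_pdivrMr ?ler_peMr //; lra.
have K0 : 0 < K%:R :> R by rewrite ltr0n.
have h2 : 0 <= (lv i - 2 * r0) / (2 * K%:R).
  by rewrite divr_ge0 // ?subr_ge0 ?mulr_ge0 // ltW // lv_gt.
have h3 : 0 <= (ls i - 2 * r0) / (2 * K%:R).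
  by rewrite divr_ge0 // ?subr_ge0 ?mulr_ge0 // ltW // ls_gt.
by move=> h4; split; lra.
Qed.

Definition vert_y i t := y0 i - chain_pos r0 (lv i) K t / N 0 1.
Definition vert_r i t := chain_radius r0 (lv i) K t.
Definition slope_u i t := chain_pos r0 (ls i) K t / N 1 m.
Definition slope_r i t := chain_radius r0 (ls i) K t.

Section ChainParts.
Variable i : nat.
Hypothesis ig : (i < g)%N.

Let n0 : 0 < N 0 1. Proof. by have [? _] := norm_dirs; lra. Qed.
Let nm : 0 < N 1 m. Proof. by have [_ ?] := norm_dirs; lra. Qed.

Lemma in_vert_chain t : (t <= K.+1)%N -> in_vert i (vert_y i t) (vert_r i t).
Proof.
move=> tK; have r00 := r0_gt0; have lg := lv_gt ig; have [l1 _] := link_le ig.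
have p0 := chain_pos_ge0 r00 lg K_gt0 tK; have p1 := chain_pos_le r00 lg K_gt0 tK.
split; last exact: chain_radius_le.
- have : chain_pos r0 (lv i) K t / N 0 1 <= y0 i + dd i.
    by rewrite ler_pdivrMr // mulrC.
  by rewrite /vert_y; lra.
- have : 0 <= chain_pos r0 (lv i) K t / N 0 1 by rewrite divr_ge0 // ltW.
  by rewrite /vert_y; lra.
- exact: chain_radius_gt0.
Qed.

Lemma in_slope_chain t : (t <= K.+1)%N -> in_slope i (slope_u i t) (slope_r i t).
Proof.
move=> tK; have r00 := r0_gt0; have lg := ls_gt ig; have [_ l1] := link_le ig.
have p0 := chain_pos_ge0 r00 lg K_gt0 tK; have p1 := chain_pos_le r00 lg K_gt0 tK.
have [/ltW m0 _ _] := m_bnd.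
have u0 : 0 <= slope_u i t by rewrite divr_ge0 // ltW.
have u1 : slope_u i t <= X - sigma * s i by rewrite ler_pdivrMr // mulrC.
split => //; first by rewrite mulr_ge0.
  by apply: le_trans (ler_wpM2l m0 u1) _; rewrite mulrBr mX.
by apply/andP; split; [exact: chain_radius_gt0|exact: chain_radius_le].
Qed.

Lemma vert_N t t' : N 0 (vert_y i t - vert_y i t') =
  `|chain_pos r0 (lv i) K t' - chain_pos r0 (lv i) K t|.
Proof.
have -> : vert_y i t - vert_y i t' =
    (chain_pos r0 (lv i) K t' - chain_pos r0 (lv i) K t) / N 0 1 * 1.
  by rewrite /vert_y; ring.
rewrite -{1}(mulr0 ((chain_pos r0 (lv i) K t' - chain_pos r0 (lv i) K t) / N 0 1)) N_hom.
by rewrite normrM normfV (gtr0_norm n0) divfK // gt_eqF.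
Qed.

Lemma slope_N t t' :
  N (slope_u i t - slope_u i t') (m * slope_u i t - m * slope_u i t') =
  `|chain_pos r0 (ls i) K t - chain_pos r0 (ls i) K t'|.
Proof.
set u := chain_pos r0 (ls i) K t - chain_pos r0 (ls i) K t'.
have -> : slope_u i t - slope_u i t' = u / N 1 m * 1 by rewrite /slope_u /u; ring.
have -> : m * slope_u i t - m * slope_u i t' = u / N 1 m * m by rewrite /slope_u /u; ring.
by rewrite N_hom normrM normfV (gtr0_norm nm) divfK // gt_eqF.
Qed.

Lemma sep_vert_lt J t t' : (t < t' <= K.+1)%N ->
  sep (J + xw i) (vert_y i t) (vert_r i t) (J + xw i) (vert_y i t') (vert_r i t').
Proof.
move=> /andP[tt tK]; rewrite /sep subrr vert_N.
apply: le_trans (ler_norm _); apply: chain_sep => //; [exact: r0_gt0|exact: lv_gt].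
Qed.

Lemma sep_slope_lt J t t' : (t < t' <= K.+1)%N ->
  sep (J + xw i + slope_u i t) (- dd i + m * slope_u i t) (slope_r i t)
      (J + xw i + slope_u i t') (- dd i + m * slope_u i t') (slope_r i t').
Proof.
move=> /andP[tt tK]; apply: sep_sym; rewrite /sep addrC.
have -> : J + xw i + slope_u i t' - (J + xw i + slope_u i t) =
  slope_u i t' - slope_u i t by ring.
have -> : - dd i + m * slope_u i t' - (- dd i + m * slope_u i t) =
  m * slope_u i t' - m * slope_u i t by ring.
rewrite slope_N; apply: le_trans (ler_norm _); apply: chain_sep => //.
  exact: r0_gt0.
exact: ls_gt.
Qed.

Lemma vert_y0 : vert_y i 0 = y0 i.
Proof. by rewrite /vert_y chain_pos0 mul0r subr0. Qed.

Lemma vert_yK : vert_y i K.+1 = - dd i.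
Proof.
by rewrite /vert_y chain_posK /lv mulrAC divff ?gt_eqF // mul1r; ring.
Qed.

Lemma slope_u0 : slope_u i 0 = 0.
Proof. by rewrite /slope_u chain_pos0 mul0r. Qed.

Lemma slope_uK : slope_u i K.+1 = X - sigma * s i.
Proof. by rewrite /slope_u chain_posK /ls mulrAC divff ?gt_eqF // mul1r. Qed.

Lemma sep_vert_slope J t t' : (t <= K.+1)%N -> (0 < t' <= K.+1)%N ->
  sep (J + xw i) (vert_y i t) (vert_r i t)
    (J + xw i + slope_u i t') (- dd i + m * slope_u i t') (slope_r i t').
Proof.
move=> tK /andP[t'0 t'K]; have [t0|t0] := posnP t.
  by move: (in_vert_chain tK); subst t; rewrite vert_y0 => h;
    apply: sep_vert0_slope => //; exact: in_slope_chain.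
(* The last vertical ball is also ball [0] of the sloped chain. *)
have [->|tK'] := eqVneq t K.+1.
  rewrite vert_yK; have := @sep_slope_lt J 0 t'; rewrite t'0 t'K slope_u0 mulr0 !addr0.
  by rewrite /slope_r /vert_r {1}/chain_radius /= {2}/chain_radius eqxx orbT; apply.
apply: sep_x.
have r00 := r0_gt0; have lg := ls_gt ig; have l1 := link_small ig.
have -> : vert_r i t = (lv i - 2 * r0) / (2 * K%:R).
  rewrite /vert_r /chain_radius (negbTE tK') orbF; case: eqP => // e.
  by rewrite e in t0.
have [->|t'K'] := eqVneq t' K.+1.
  rewrite slope_uK /slope_r {1}/chain_radius eqxx orbT.
  have [l2 _] := link_le ig; have [[? ?] [? ?] [? ?] _] := scale_bnd ig.
  have [? ? _ _] := eta_bnd; have ? := X_big; have ? := S_ge.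
  by move: l2; rewrite /r0; lra.
have er : slope_r i t' = (ls i - 2 * r0) / (2 * K%:R).
  rewrite /slope_r /chain_radius (negbTE t'K') orbF; case: eqP => // e.
  by rewrite e in t'0.
have : (r0 + slope_r i t') / N 1 m <= slope_u i t'.
  by rewrite ler_wpM2r ?invr_ge0 ?(ltW nm) // chain_pos_ge // t'0.
have : 0 <= slope_r i t' / N 1 m.
  by rewrite divr_ge0 // ltW //; exact: chain_radius_gt0.
by rewrite mulrDl -er in l1 *; lra.
Qed.

End ChainParts.

(** [inl true] is [A] and [inl false] is [B]. The sloped chain is listed from its ball [1] on, its
    ball [0] being the last one of the vertical chain. *)
Definition part := (bool + ('I_K.+2 + 'I_K.+1))%type.

Definition part_x i (p : part) : R :=
  match p with
  | inl true => Ax i | inl false => Ay i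
  | inr (inl t) => xw i | inr (inr t) => xw i + slope_u i t.+1
  end.

Definition part_y i (p : part) : R :=
  match p with
  | inl true => Ay i | inl false => Ax i
  | inr (inl t) => vert_y i t | inr (inr t) => - dd i + m * slope_u i t.+1
  end.

Definition part_r i (p : part) : R :=
  match p with
  | inl _ => s i
  | inr (inl t) => vert_r i t | inr (inr t) => slope_r i t.+1
  end.

Lemma part_r_gt0 i p : (i < g)%N -> 0 < part_r i p.
Proof.
move=> ig; have s0 : 0 < s i by apply: lt_le_trans (s_ge1 i).
by case: p => [[]|[t|t]] //=; apply: chain_radius_gt0 => //;
  [exact: r0_gt0|exact: lv_gt|exact: r0_gt0|exact: ls_gt].
Qed.

Lemma part_band i p : (i < g)%N ->
  - S <= part_y i p - part_r i p /\ part_y i p + part_r i p <= S.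
Proof.
move=> ig; case: p => [[]|[t|t]] /=.
- exact: band_A.
- exact: band_B.
- by apply: (band_vert ig); apply: in_vert_chain => //; rewrite -ltnS.
- by apply: (band_slope ig); apply: in_slope_chain => //; rewrite ltnS -ltnS.
Qed.

(** * Separation of all pieces of one level *)

Section Band.
Variable J : nat -> R.
Hypothesis J_lt : forall j j', (j < j')%N -> offset (J j) (J j').
Hypothesis J_succ : forall j, J j.+1 = J j + X.

Definition psep j i p j' i' p' := sep (J j + part_x i p) (part_y i p) (part_r i p)
  (J j' + part_x i' p') (part_y i' p') (part_r i' p').

Lemma psep_sym j i p j' i' p' : psep j i p j' i' p' -> psep j' i' p' j i p.
Proof. exact: sep_sym. Qed.

Let Sl t := inr (inr t) : part.
Let Ve t := inr (inl t) : part.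

Lemma psep_col j i p j' i' p' : (i < g)%N -> (i' < g)%N ->
  (if p is inl false then False else if p is inr (inr _) then False else True) ->
  (if p' is inl false then False else if p' is inr (inr _) then False else True) ->
  j <> j' \/ i <> i' -> psep j i p j' i' p'.
Proof.
move=> ig ig' hp hp' H.
have col k l (pp : part) : (l < g)%N ->
    (if pp is inl false then False else if pp is inr (inr _) then False else True) ->
    in_col (J k) l (J k + part_x l pp) (part_r l pp).
  case: pp => [[]|[t|t]] //= lg _; first exact: in_col_A.
  by apply: (@in_col_vert _ _ lg (vert_y l t)); apply: in_vert_chain => //; rewrite -ltnS.
rewrite /psep; have c := col j i p ig hp; have c' := col j' i' p' ig' hp'.
case: (ltngtP j j') => jj.
- by apply: (sep_col_lt _ _ ig ig' c c'); left; exact: J_lt.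
- by apply: sep_sym; apply: (sep_col_lt _ _ ig' ig c' c); left; exact: J_lt.
- case: (ltngtP i i') => ii.
  + by apply: (sep_col_lt _ _ ig ig' c c'); right; split; rewrite ?jj.
  + by apply: sep_sym; apply: (sep_col_lt _ _ ig' ig c' c); right; split; rewrite ?jj.
  + by case: H.
Qed.

Lemma psep_slope_col_off j i p j' i' t : (i < g)%N -> (i' < g)%N ->
  (if p is inl false then False else if p is inr (inr _) then False else True) ->
  j <> j' \/ (i < i')%N -> psep j i p j' i' (Sl t).
Proof.
move=> ig ig' hp H; rewrite /psep /= (addrA _ (xw _)).
have c : in_col (J j) i (J j + part_x i p) (part_r i p).
  case: p hp => [[]|[t'|t']] //= _; first exact: in_col_A.
  by apply: (@in_col_vert _ _ ig (vert_y i t')); apply: in_vert_chain => //; rewrite -ltnS.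
apply: (sep_col_slope_off ig ig' _ c).
  by apply: in_slope_chain => //; rewrite ltnS -ltnS.
case: (ltngtP j j') => jj.
- by constructor 2; exact: J_lt.
- by constructor 1; exact: J_lt.
- by constructor 3; subst j'; split=> //; case: H.
Qed.

Lemma psep_A_slope j i j' i' t : (i < g)%N -> (i' < g)%N ->
  psep j i (inl true) j' i' (Sl t).
Proof.
move=> ig ig'; have [jj|jj] := eqVneq j j'; last first.
  by apply: psep_slope_col_off => //; left; apply/eqP.
case: (ltnP i i') => ii; first by apply: psep_slope_col_off => //; right.
subst j'; rewrite /psep /= (addrA _ (xw _)); apply: sep_A_slope => //.
  by apply: in_slope_chain => //; rewrite ltnS -ltnS.
by move: ii; rewrite leq_eqVlt => /orP[/eqP->|]; [right|left].
Qed.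

Lemma psep_vert_slope j i t' j' i' t : (i < g)%N -> (i' < g)%N ->
  psep j i (Ve t') j' i' (Sl t).
Proof.
move=> ig ig'; have [jj|jj] := eqVneq j j'; last first.
  by apply: psep_slope_col_off => //; left; apply/eqP.
case: (ltngtP i i') => ii; first by apply: psep_slope_col_off => //; right.
  subst j'; rewrite /psep /= (addrA _ (xw _)); apply: sep_vert_slope_lt => //.
    by apply: in_vert_chain => //; rewrite -ltnS.
  by apply: in_slope_chain => //; rewrite ltnS -ltnS.
subst j' i'; rewrite /psep /= (addrA _ (xw _)); apply: sep_vert_slope => //.
  by rewrite -ltnS.
by rewrite /= ltn_ord.
Qed.

Lemma psep_B_slope j i j' i' t : (i < g)%N -> (i' < g)%N ->
  psep j i (inl false) j' i' (Sl t).
Proof.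
move=> ig ig'; rewrite /psep /= (addrA _ (xw _)); apply: sep_B_slope => //.
  by apply: in_slope_chain => //; rewrite ltnS -ltnS.
case: (ltngtP j j') => jj.
- by constructor 3; exact: J_lt.
- case: (ltngtP j j'.+1) => jj'.
  + by move: jj' jj; rewrite ltnS ltnNge => ->.
  + by constructor 4; rewrite -J_succ; exact: J_lt.
  + by constructor 1; rewrite jj' J_succ.
- by constructor 2; rewrite jj.
Qed.

Lemma psep_slope_slope j i t j' i' t' : (i < g)%N -> (i' < g)%N ->
  (j, i, Sl t) <> (j', i', Sl t') -> psep j i (Sl t) j' i' (Sl t').
Proof.
move=> ig ig' ne; rewrite /psep /= !(addrA _ (xw _)).
have c : in_slope i (slope_u i t.+1) (slope_r i t.+1).
  by apply: in_slope_chain => //; rewrite ltnS -ltnS.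
have c' : in_slope i' (slope_u i' t'.+1) (slope_r i' t'.+1).
  by apply: in_slope_chain => //; rewrite ltnS -ltnS.
case: (ltngtP j j') => jj.
- by apply: sep_slope_slope => //; left; exact: J_lt.
- by apply: sep_sym; apply: sep_slope_slope => //; left; exact: J_lt.
subst j'; case: (ltngtP i i') => ii.
- by apply: sep_slope_slope => //; right.
- by apply: sep_sym; apply: sep_slope_slope => //; right.
subst i'; case: (ltngtP t t') => tt.
- by apply: sep_slope_lt => //; rewrite !ltnS tt /= -ltnS.
- by apply: sep_sym; apply: sep_slope_lt => //; rewrite !ltnS tt /= -ltnS.
by case: ne; congr (_, inr (inr _)); apply: ord_inj.
Qed.

Lemma psep_vert_vert j i t j' i' t' : (i < g)%N -> (i' < g)%N ->
  (j, i, Ve t) <> (j', i', Ve t') -> psep j i (Ve t) j' i' (Ve t').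
Proof.
move=> ig ig' ne.
have [jj|jj] := eqVneq j j'; last by apply: psep_col => //; left; apply/eqP.
have [ii|ii] := eqVneq i i'; last by apply: psep_col => //; right; apply/eqP.
subst j' i'; rewrite /psep /=; case: (ltngtP t t') => tt.
- by apply: sep_vert_lt => //; rewrite tt /= -ltnS.
- by apply: sep_sym; apply: sep_vert_lt => //; rewrite tt /= -ltnS.
by case: ne; congr (_, inr (inl _)); apply: ord_inj.
Qed.

Lemma psep_A_vert j i j' i' t : (i < g)%N -> (i' < g)%N ->
  psep j i (inl true) j' i' (Ve t).
Proof.
move=> ig ig'.
have [jj|jj] := eqVneq j j'; last by apply: psep_col => //; left; apply/eqP.
have [ii|ii] := eqVneq i i'; last by apply: psep_col => //; right; apply/eqP.
by subst j' i'; rewrite /psep; apply: sep_A_vert => //; apply: in_vert_chain => //; rewrite -ltnS.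
Qed.

Lemma psep_B_vert j i j' i' t : (i < g)%N -> (i' < g)%N ->
  psep j i (inl false) j' i' (Ve t).
Proof.
by move=> ig ig'; rewrite /psep; apply: sep_B_vert => //; apply: in_vert_chain => //; rewrite -ltnS.
Qed.

Lemma psep_B_B j i j' i' : (i < g)%N -> (i' < g)%N -> j <> j' \/ i <> i' ->
  psep j i (inl false) j' i' (inl false).
Proof.
move=> ig ig' H; rewrite /psep /=; case: (ltngtP i i') => ii.
- by apply: sep_BB_lt => //; left.
- by apply: sep_sym; apply: sep_BB_lt => //; left.
subst i'; case: (ltngtP j j') => jj.
- by apply: sep_BB_lt => //; right; split => //; exact: J_lt.
- by apply: sep_sym; apply: sep_BB_lt => //; right; split => //; exact: J_lt.
- by case: H.
Qed.

Lemma psep_A_B j i j' i' : (i < g)%N -> (i' < g)%N -> j <> j' ->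
  psep j i (inl true) j' i' (inl false).
Proof.
move=> ig ig' /eqP jj; rewrite /psep; apply: sep_AB_off => //.
by case: (ltngtP j j') jj => // jj _; [left|right]; exact: J_lt.
Qed.

(** The exception does not ask for [i = i'], because [A_core_B] deals with every [A] and every [B]
    of a corner at once. *)
Lemma psep_all j i p j' i' p' : (i < g)%N -> (i' < g)%N ->
  (j, i, p) <> (j', i', p') ->
  psep j i p j' i' p' \/ j = j' /\ exists c, p = inl c /\ p' = inl (~~ c).
Proof.
move=> ig ig' ne; case: p ne => [[]|[t|t]]; case: p' => [[]|[t'|t']] ne.
- left; apply: psep_col => //.
  have [jj|/eqP] := eqVneq j j'; last by left.
  by right=> ii; apply: ne; rewrite jj ii.
- have [jj|/eqP jj] := eqVneq j j'; last by left; exact: psep_A_B.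
  by right; split => //; exists true.
- by left; exact: psep_A_vert.
- by left; exact: psep_A_slope.
- have [jj|/eqP jj] := eqVneq j j'; last by left; apply/psep_sym/psep_A_B => // e; apply: jj.
  by right; split => //; exists false.
- left; apply: psep_B_B => //.
  have [jj|/eqP] := eqVneq j j'; last by left.
  by right=> ii; apply: ne; rewrite jj ii.
- by left; exact: psep_B_vert.
- by left; exact: psep_B_slope.
- by left; apply/psep_sym/psep_A_vert.
- by left; apply/psep_sym/psep_B_vert.
- by left; exact: psep_vert_vert.
- by left; exact: psep_vert_slope.
- by left; apply/psep_sym/psep_A_slope.
- by left; apply/psep_sym/psep_B_slope.
- by left; apply/psep_sym/psep_vert_slope.
- by left; exact: psep_slope_slope.
Qed.

Lemma psep_up j i p j' : (i < g)%N ->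
  sep (J j + part_x i p) (part_y i p) (part_r i p) (J j' + S) S S \/
  j = j' /\ exists c, p = inl c.
Proof.
move=> ig; case: p => [[]|[t|t]] /=.
- case: (ltngtP j j') => jj; last by right; split => //; exists true.
  + by left; apply: sep_A_up => //; left; exact: J_lt.
  + by left; apply: sep_A_up => //; right; exact: J_lt.
- case: (ltngtP j j') => jj; last by right; split => //; exists false.
  + by left; apply: sep_B_up => //; left; exact: J_lt.
  + by left; apply: sep_B_up => //; right; exact: J_lt.
- by left; apply: sep_vert_up => //; apply: in_vert_chain => //; rewrite -ltnS.
- left; rewrite (addrA _ (xw _)); apply: sep_slope_up => //.
    by apply: in_slope_chain => //; rewrite ltnS -ltnS.
  case: (ltngtP j j') => jj; first by constructor 2; exact: J_lt.
    by constructor 3; exact: J_lt.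
  by constructor 1; rewrite jj.
Qed.

(** At the corner itself [A] stays to the right of the lower hub and [B] above it, so a crossing
    overlaps the upper hub alone. *)
Lemma psep_low j i p j' : (i < g)%N ->
  sep (J j + part_x i p) (part_y i p) (part_r i p) (J j' - S) (- S) S.
Proof.
move=> ig.
have three : [\/ J j = J j', offset (J j) (J j') | offset (J j') (J j)].
  case: (ltngtP j j') => jj; first by constructor 2; exact: J_lt.
    by constructor 3; exact: J_lt.
  by constructor 1; rewrite jj.
case: p => [[]|[t|t]] /=.
- exact: sep_A_low.
- exact: sep_B_low.
- by apply: sep_vert_low => //; apply: in_vert_chain => //; rewrite -ltnS.
- rewrite (addrA _ (xw _)); apply: sep_slope_low => //.
    by apply: in_slope_chain => //; rewrite ltnS -ltnS.
  case: (ltngtP j j') => jj; last by constructor 1; rewrite jj.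
    case: (ltngtP j.+1 j') => jj'; last by constructor 2; rewrite -jj' J_succ.
      by constructor 3; rewrite -J_succ; exact: J_lt.
    by move: jj'; rewrite ltnS leqNgt jj.
  by constructor 4; exact: J_lt.
Qed.

End Band.

(** * The whole arrangement *)

Variables G k : nat.

Definition vertices := option ('I_G.+1 * 'I_k + 'I_G * 'I_k * 'I_g * part)%type.

Definition hub a j : vertices := Some (inl (a, j)).
Definition piece a j i p : vertices := Some (inr (a, j, i, p)).

(** The point where hubs [a] and [a.+1] of column [j] meet. Columns descend diagonally, by [2 * S]
    in both coordinates per level, so all levels look alike. *)
Definition base_x (a j : nat) : R := j%:R * X - 2 * (S * a%:R) - S.
Definition base_y (a : nat) : R := - 2 * (S * a%:R) - S.
(** The bottom side of the huge ball has length [sigma * top_radius], enough to hold the upper right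
    corners of the top hubs of all columns. *)
Definition top_radius := k.+1%:R * X / sigma.

Definition vx (v : vertices) : R :=
  match v with
  | None => S + top_radius
  | Some (inl (a, j)) => base_x a j + S
  | Some (inr (a, j, i, p)) => base_x a j + part_x i p
  end.

Definition vy (v : vertices) : R :=
  match v with
  | None => S + top_radius
  | Some (inl (a, j)) => base_y a + S
  | Some (inr (a, j, i, p)) => base_y a + part_y i p
  end.

Definition vr (v : vertices) : R :=
  match v with
  | None => top_radius
  | Some (inl _) => S
  | Some (inr (_, i, p)) => part_r i p
  end.

Lemma S_gt0 : 0 < S. Proof. by have := S_ge; move: W_ge1; lra. Qed.
Lemma X_gt0 : 0 < X.
Proof. by have := X_big; have := S_gt0; move: W_ge1; lra. Qed.
Lemma sigma_gt0 : 0 < sigma. Proof. by have /andP[] := sigma_bnd. Qed.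

Lemma vr_gt0 v : 0 < vr v.
Proof.
case: v => [[[a j]|[[[a j] i] p]]|] /=; first exact: S_gt0.
  exact: part_r_gt0.
by rewrite /top_radius divr_gt0 ?sigma_gt0 // mulr_gt0 ?ltr0n // X_gt0.
Qed.

Lemma base_x_lt a j j' : (j < j')%N -> offset (base_x a j) (base_x a j').
Proof.
move=> jj; rewrite /offset /base_x.
have : j%:R * X + X <= j'%:R * X.
  by rewrite -{2}[X]mul1r -mulrDl natr1 ler_wpM2r ?ler_nat // ltW // X_gt0.
lra.
Qed.

Lemma base_x_succ a j : base_x a j.+1 = base_x a j + X.
Proof. by rewrite /base_x -natr1; ring. Qed.

Lemma base_y_lt a a' : (a < a')%N -> base_y a' + 2 * S <= base_y a.
Proof.
move=> aa; rewrite /base_y.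
have : S * a%:R + S <= S * a'%:R.
  by rewrite -{2}[S]mulr1 -mulrDr natr1 ler_wpM2l ?ler_nat // ltW // S_gt0.
lra.
Qed.

Lemma base_y_succ a : base_y a.+1 = base_y a - 2 * S.
Proof. by rewrite /base_y -natr1; ring. Qed.

Lemma base_y_le a : base_y a <= - S.
Proof.
rewrite /base_y; have : 0 <= S * a%:R by rewrite mulr_ge0 // ltW // S_gt0.
lra.
Qed.

Lemma base_x_down a j : base_x a.+1 j + S = base_x a j - S.
Proof. by rewrite /base_x -natr1; ring. Qed.

Lemma sep_shift b x y r x' y' r' :
  sep x y r x' y' r' -> sep x (b + y) r x' (b + y') r'.
Proof. by rewrite /sep (_ : b + y - (b + y') = y - y'); last ring. Qed.

Definition vsep u v := sep (vx u) (vy u) (vr u) (vx v) (vy v) (vr v).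

Definition overlap (u v : vertices) : Prop :=
  match u, v with
  | Some (inl (a, j)), Some (inr (a', j', _, inl _)) => a = a' :> nat /\ j = j'
  | Some (inr (a, j, _, inl c)), Some (inr (a', j', _, inl c')) =>
      [/\ a = a', j = j' & c' = ~~ c]
  | _, _ => False
  end.

Lemma hub_piece_sep a' j' a j i p : let u := hub a' j' in let v := piece a j i p in
  vsep u v \/ overlap u v.
Proof.
rewrite /=; have [lo hi] := part_band p (ltn_ord i).
have S0 := S_gt0.
case: (ltngtP a' a) => aa.
- left; apply/sep_sym/sep_y => /=; have := base_y_lt aa; lra.
- have [aS|aS] := eqVneq (a' : nat) a.+1.
    left; rewrite /vsep /= aS base_x_down base_y_succ.
    rewrite (_ : base_y a - 2 * S + S = base_y a + - S); last ring.
    apply/sep_shift/sep_sym.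
    exact: (psep_low (@base_x_lt a) (base_x_succ a) j p j' (ltn_ord i)).
  have aa' : (a.+1 < a')%N by rewrite ltn_neqAle eq_sym aS aa.
  left; apply/sep_y => /=; have := base_y_lt aa'; rewrite base_y_succ; lra.
- have [h|[jj [c pc]]] := psep_up (@base_x_lt a) j p j' (ltn_ord i).
    left; rewrite /vsep /= aa; apply/sep_shift/sep_sym; exact: h.
  by right; rewrite pc /=; split => //; apply: ord_inj.
Qed.

Lemma piece_piece_sep a j i p a' j' i' p' :
  let u := piece a j i p in let v := piece a' j' i' p' in
  u <> v -> vsep u v \/ overlap u v.
Proof.
move=> u v uv; have [lo hi] := part_band p (ltn_ord i).
have [lo' hi'] := part_band p' (ltn_ord i').
case: (ltngtP a a') => aa.
- left; apply/sep_sym/sep_y => /=; have := base_y_lt aa; lra.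
- left; apply/sep_y => /=; have := base_y_lt aa; lra.
have aE : a = a' by apply: ord_inj.
subst a'; have ne : (j : nat, i : nat, p) <> (j' : nat, i' : nat, p').
  by case=> /ord_inj ej /ord_inj ei ep; apply: uv; rewrite /u /v ej ei ep.
have [h|[jj [c [pc pc']]]] :=
  psep_all (@base_x_lt a) (base_x_succ a) (ltn_ord i) (ltn_ord i') ne.
  by left; rewrite /vsep /=; apply: sep_shift.
by right; rewrite /u /v pc pc' /=; split => //; apply: ord_inj.
Qed.

Lemma hub_hub_sep a j a' j' : hub a j <> hub a' j' -> vsep (hub a j) (hub a' j').
Proof.
move=> ne; have XX := X_big; have S0 := S_gt0; have W0 := W_ge1.
case: (ltngtP a a') => aa.
- apply/sep_sym/sep_y => /=; have := base_y_lt aa; lra.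
- apply/sep_y => /=; have := base_y_lt aa; lra.
have aE : a = a' by apply: ord_inj.
subst a'; case: (ltngtP j j') => jj.
- by apply/sep_x => /=; have := base_x_lt a jj; rewrite /offset; lra.
- by apply/sep_sym/sep_x => /=; have := base_x_lt a jj; rewrite /offset; lra.
by case: ne; congr (Some (inl (_, _))); apply: ord_inj.
Qed.

Lemma top_sep v : v <> None -> vsep v None.
Proof.
have S0 := S_gt0; case: v => [[[a j]|[[[a j] i] p]]|] // _; apply: sep_y => /=.
  by have := base_y_le a; lra.
by have [_ hi] := part_band p (ltn_ord i); have := base_y_le a; lra.
Qed.

Lemma vsep_sym u v : vsep u v -> vsep v u.
Proof. exact: sep_sym. Qed.

Lemma vertices_sep u v : u <> v -> [\/ vsep u v, overlap u v | overlap v u].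
Proof.
case: u => [[[a j]|[[[a j] i] p]]|]; last first.
- by move=> ne; constructor 1; apply/vsep_sym/top_sep => e; rewrite e in ne.
- case: v => [[[a' j']|[[[a' j'] i'] p']]|] ne.
  + have [h|h] := hub_piece_sep a' j' a j i p; last by constructor 3.
    by constructor 1; exact: vsep_sym.
  + by have [h|h] := piece_piece_sep ne; [constructor 1|constructor 2].
  + by constructor 1; exact: top_sep.
- case: v => [[[a' j']|[[[a' j'] i'] p']]|] ne.
  + by constructor 1; exact: hub_hub_sep.
  + by have [h|h] := hub_piece_sep a j a' j' i' p'; [constructor 1|constructor 2].
  + by constructor 1; exact: top_sep.
Qed.

(* The core of an [A]-piece lies in a lower half-plane, that of a [B]-piece in a
   left half-plane, and any other core is a smaller concentric ball. *)
Definition core_free (v u : vertices) : Prop :=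
  (1 - kap) * vr v + vr u < N (vx v - vx u) (vy v - vy u) \/
  match v with
  | Some (inr (_, inl true)) => vy v + (sigma - 1 - kap) * vr v < vy u - vr u
  | Some (inr (_, inl false)) => vx v + (sigma - 1 - kap) * vr v < vx u - vr u
  | _ => False
  end.

(** Separated balls become strictly separated once one of them is shrunk. An overlapping pair is
    either a hub with a piece at its corner, where the hub keeps its smaller ball and the piece its
    half-plane, or an [A] with a [B], where each half-plane misses the other ball. *)
Lemma vertices_core_free v u : v <> u -> core_free v u.
Proof.
move=> vu; have [e0 _ _ ek] := eta_bnd.
have [h|h|h] := vertices_sep vu.
- left; have h1 := vr_gt0 v; apply: lt_le_trans h.
  have : 0 < kap * vr v by rewrite mulr_gt0 // (lt_trans e0).
  lra.
- case: v u h {vu} => [[[a j]|[[[a j] i] [c|?]]]|] // [[?|[[[a' j'] i'] [c'|?]]]|] //=.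
    case=> aE ->; left; rewrite /= aE.
    have -> : base_y a' + S - (base_y a' + part_y i' (inl c')) = S - part_y i' (inl c') by ring.
    by case: c'; [exact: hub_A_core|exact: hub_B_core].
  case=> -> -> ->; right; have h1 := A_core_B (ltn_ord i) (ltn_ord i').
  have h2 := A_core_B (ltn_ord i') (ltn_ord i).
  by case: c => /=; lra.
- case: u v h {vu} => [[[a j]|[[[a j] i] [c|?]]]|] // [[?|[[[a' j'] i'] [c'|?]]]|] //=.
    case=> aE ->; right; rewrite /= aE.
    case: c' => /=.
      by have := A_core_low i'; lra.
    by have := A_core_low i'; rewrite /=; lra.
  case=> -> -> ->; right; have h1 := A_core_B (ltn_ord i) (ltn_ord i').
  have h2 := A_core_B (ltn_ord i') (ltn_ord i).
  by case: c => /=; lra.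
Qed.

(** * The graph, its columns and its wires *)

Definition touch : rel vertices := fun u v =>
  (u != v) && (N (vx u - vx v) (vy u - vy v) <= vr u + vr v).

Lemma touch_sym : symmetric touch.
Proof.
move=> u v; rewrite /touch eq_sym [vr v + _]addrC.
by rewrite -[vx v - _]opprB -[vy v - _]opprB N_opp.
Qed.

Lemma touch_irr : irreflexive touch.
Proof. by move=> u; rewrite /touch eqxx. Qed.

Lemma touch_hub_hub (a a' : 'I_G.+1) j : a' = a.+1 :> nat ->
  touch (hub a j) (hub a' j).
Proof.
move=> aE; apply/andP; split.
  by apply/eqP => -[e]; move: aE; rewrite e => /esym/eqP; rewrite eqn_leq ltnn.
rewrite /= aE base_x_down base_y_succ.
have -> : base_x a j + S - (base_x a j - S) = (S + S) * 1 by ring.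
have -> : base_y a + S - (base_y a - 2 * S + S) = (S + S) * 1 by ring.
have S0 : 0 <= S + S by rewrite addr_ge0 // ltW // S_gt0.
by rewrite N_hom ger0_norm // -[leRHS]mulr1 ler_wpM2l.
Qed.

Lemma touch_hub_A (a : 'I_G.+1) (a' : 'I_G) j i : a = a' :> nat ->
  touch (hub a j) (piece a' j i (inl true)).
Proof.
move=> aE; apply/andP; split => //=; rewrite aE.
have -> : base_x a' j + S - (base_x a' j + Ax i) = S - Ax i by ring.
have -> : base_y a' + S - (base_y a' + Ay i) = S - Ay i by ring.
exact: hub_touches_A.
Qed.

Lemma touch_top j : touch None (hub ord0 j).
Proof.
have S0 := S_gt0; have g0 := sigma_gt0; have X0 := X_gt0.
have RD := vr_gt0 None; apply/andP; split => //=.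
rewrite /base_x /base_y /= !mulr0 oppr0.
set D := top_radius; rewrite /= -/D in RD.
(* The position of the contact on the bottom side of the huge ball: the side runs from the corner
   [(-1, -1)], at [l = 0], to [(sigma - 1, -1)], at [l = 1]. *)
pose l := j%:R * X / (sigma * D).
have l0 : 0 <= l.
  by apply: divr_ge0; apply: mulr_ge0; [exact: ler0n|exact: ltW|exact: ltW|exact: ltW].
have jk : (j%:R : R) <= k.+1%:R by rewrite ler_nat; apply/leqW/ltnW/ltn_ord.
have l1 : l <= 1.
  have sD : sigma * D = k.+1%:R * X.
    by rewrite /D /top_radius mulrC divfK // gt_eqF.
  rewrite /l sD ler_pdivrMr; last by rewrite mulr_gt0 ?ltr0n.
  by rewrite mul1r ler_wpM2r // ltW.
have lE : l * sigma * D = j%:R * X by rewrite /l; field; rewrite !gt_eqF.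
have -> : S + D - (j%:R * X + 0 - S + S) =
    (S * 1 + (1 - l) * D * 1) + l * D * (1 - sigma) by rewrite -lE; ring.
have -> : S + D - (0 - S + S) = (S * 1 + (1 - l) * D * 1) + l * D * 1 by ring.
apply: le_trans (N_tri _ _ _ _) _.
apply: le_trans (lerD (N_tri _ _ _ _) (lexx _)) _.
have h1 : 0 <= (1 - l) * D by rewrite mulr_ge0 ?subr_ge0 // ltW.
have h2 : 0 <= l * D by rewrite mulr_ge0 // ltW.
rewrite !N_hom !ger0_norm // ?(ltW S0) //.
have e1 : S * N 1 1 <= S * 1 by rewrite ler_wpM2l // ltW.
have e2 : (1 - l) * D * N 1 1 <= (1 - l) * D * 1 by rewrite ler_wpM2l.
have e3 : l * D * N (1 - sigma) 1 <= l * D * 1 by rewrite ler_wpM2l.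
by lra.
Qed.

Section WireSteps.
Variables (a : 'I_G) (j : 'I_k) (i : 'I_g).

Let pc p := piece a j i p.
Let ve t := pc (inr (inl (inord t))).
Let sl t := pc (inr (inr (inord t))).

Lemma piece_touch p p' : p <> p' ->
  N (part_x i p - part_x i p') (part_y i p - part_y i p') <= part_r i p + part_r i p' ->
  touch (pc p) (pc p').
Proof.
move=> ne h; apply/andP; split; first by apply/eqP => -[].
move=> /=; have -> : base_x a j + part_x i p - (base_x a j + part_x i p') =
  part_x i p - part_x i p' by ring.
by have -> : base_y a + part_y i p - (base_y a + part_y i p') =
  part_y i p - part_y i p' by ring.
Qed.

Lemma touch_A_B : touch (pc (inl true)) (pc (inl false)).
Proof. by apply: piece_touch => //; exact: A_touches_B. Qed.

Lemma touch_A_vert : touch (pc (inl true)) (ve 0).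
Proof.
apply: piece_touch => //=; rewrite inordK // vert_y0 //.
by apply: le_trans (A_touches_vert0 _) _; rewrite // /vert_r /chain_radius.
Qed.

Lemma touch_vert t : (t <= K)%N -> touch (ve t) (ve t.+1).
Proof.
move=> tK; apply: piece_touch => /=.
  by case=> /(congr1 val) /=; rewrite !inordK ?ltnS ?(leqW tK) // => /eqP; rewrite eqn_leq ltnn andbF.
rewrite !inordK ?ltnS ?(leqW tK) // subrr vert_N //.
have r00 := r0_gt0; have lg := lv_gt (ltn_ord i).
have e := chain_touch r00 lg K_gt0 tK; rewrite /vert_r.
rewrite e ger0_norm // addr_ge0 // ltW //; exact: chain_radius_gt0.
Qed.

Lemma slope_step t : (t <= K)%N ->
  N (slope_u i t - slope_u i t.+1) (m * slope_u i t - m * slope_u i t.+1) <=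
  slope_r i t + slope_r i t.+1.
Proof.
move=> tK; rewrite slope_N // distrC.
have r00 := r0_gt0; have lg := ls_gt (ltn_ord i).
have e := chain_touch r00 lg K_gt0 tK; rewrite /slope_r.
rewrite e ger0_norm // addr_ge0 // ltW //; exact: chain_radius_gt0.
Qed.

Lemma touch_vert_slope : touch (ve K.+1) (sl 0).
Proof.
apply: piece_touch => //=; rewrite !inordK // vert_yK //.
have := slope_step (leq0n K); rewrite slope_u0 mulr0.
have -> : xw i - (xw i + slope_u i 1) = 0 - slope_u i 1 by ring.
have -> : - dd i - (- dd i + m * slope_u i 1) = 0 - m * slope_u i 1 by ring.
by rewrite /vert_r /slope_r {1 3}/chain_radius /= eqxx.
Qed.

Lemma touch_slope t : (t < K)%N -> touch (sl t) (sl t.+1).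
Proof.
move=> tK; apply: piece_touch => /=.
  by case=> /(congr1 val) /=; rewrite !inordK ?ltnS ?(ltnW tK) // => /eqP; rewrite eqn_leq ltnn andbF.
rewrite !inordK ?ltnS ?(ltnW tK) //.
have -> : xw i + slope_u i t.+1 - (xw i + slope_u i t.+2) =
  slope_u i t.+1 - slope_u i t.+2 by ring.
have -> : - dd i + m * slope_u i t.+1 - (- dd i + m * slope_u i t.+2) =
  m * slope_u i t.+1 - m * slope_u i t.+2 by ring.
exact: slope_step.
Qed.

Lemma touch_next_B (j' : 'I_k) : j' = j.+1 :> nat ->
  touch (sl K) (piece a j' i (inl false)).
Proof.
move=> jj; rewrite touch_sym /sl /pc; apply/andP; split; first by apply/eqP => -[].
rewrite /= inordK // jj base_x_succ.
rewrite (_ : base_x a j + X + Ay i - (base_x a j + (xw i + slope_u i K.+1)) =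
  X + Ay i - (xw i + slope_u i K.+1)); last by ring.
rewrite (_ : base_y a + Ax i - (base_y a + (- dd i + m * slope_u i K.+1)) =
  Ax i - (- dd i + m * slope_u i K.+1)); last by ring.
apply: le_trans (B_touches_slope_end (slope_uK i)) _.
by rewrite /slope_r /chain_radius eqxx orbT.
Qed.

(** The index of [P] makes one induction serve twice: for distances it counts the contacts from [A]
    on, for connectedness it is ignored. *)
Lemma wire_steps (P : nat -> vertices -> Prop) n :
  (forall n p p', touch (pc p) (pc p') -> P n (pc p) -> P n.+1 (pc p')) ->
  P n (pc (inl true)) ->
  forall p, exists2 l, (l <= n + (2 * K + 4))%N & P l (pc p).
Proof.
move=> st PA.
have PB : P n.+1 (pc (inl false)) by apply: st PA; exact: touch_A_B.
have PV t : (t <= K.+1)%N -> P (n + t).+1 (ve t).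
  elim: t => [_|t IH tK]; first by rewrite addn0; apply: st PA; exact: touch_A_vert.
  by rewrite addnS; apply: st (IH (ltnW tK)); exact: touch_vert.
have PS t : (t <= K)%N -> P (n + K.+1 + t).+2 (sl t).
  elim: t => [_|t IH tK].
    by rewrite addn0; apply: st (PV _ (leqnn _)); exact: touch_vert_slope.
  by rewrite addnS; apply: st (IH (ltnW tK)); exact: touch_slope.
case=> [[]|[t|t]].
- by exists n; rewrite ?leq_addr.
- by exists n.+1 => //; lia.
- exists (n + t).+1; first by have := ltn_ord t; lia.
  by have := PV t; rewrite /ve inord_val -ltnS ltn_ord; apply.
- exists (n + K.+1 + t).+2; first by have := ltn_ord t; lia.
  by have := PS t; rewrite /sl inord_val -ltnS ltn_ord; apply.
Qed.

End WireSteps.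

(* Column [t] together with wire [t]; wires are numbered by [a * g + i]. *)
Definition cross (t : 'I_k) (v : vertices) : Prop :=
  match v with
  | None => False
  | Some (inl (_, j)) => j = t
  | Some (inr (a, _, i, _)) => (a * g + i)%N = t
  end.

(** The column is descended from its top hub. It touches its own wire at the [A] of column [t], and
    from there the wire is followed through the columns in both directions. *)
Lemma cross_ind (t : 'I_k) (Q : vertices -> Prop) : Q (hub ord0 t) ->
  (forall u v, cross t u -> cross t v -> touch u v -> Q u -> Q v) ->
  forall v, cross t v -> Q v.
Proof.
move=> Q0 st.
have Qhub (a : 'I_G.+1) : Q (hub a t).
  case: a => a; elim: a => [|a IH] aG.
    by rewrite (_ : Ordinal aG = ord0) //; apply: ord_inj.
  by apply: st (IH (ltnW aG)) => //; apply: touch_hub_hub.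
case=> [[[a j] /= ->|[[[a j] i] p] /= wt]|//]; first exact: Qhub.
have iffQ u v : cross t u -> cross t v -> touch u v -> (Q u <-> Q v).
  by move=> tu tv e; split; apply: st => //; rewrite touch_sym.
have Qpiece l p' : Q (piece a l i (inl true)) <-> Q (piece a l i p').
  pose P (n : nat) u := Q (piece a l i (inl true)) <-> Q u.
  have Pst n p1 p2 : touch (piece a l i p1) (piece a l i p2) ->
      P n (piece a l i p1) -> P n.+1 (piece a l i p2).
    by move=> e h; apply: iff_trans h _; apply: iffQ.
  by have [n _] := wire_steps Pst (iff_refl _ : P 0%N _) p'.
have QA n (l l' : 'I_k) : (l' = l + n :> nat)%N ->
    Q (piece a l i (inl true)) <-> Q (piece a l' i (inl true)).
  elim: n l' => [|n IH] l' ll.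
    by rewrite (_ : l' = l) //; apply: ord_inj; rewrite ll addn0.
  have ln : (l + n < k)%N by rewrite (leq_trans _ (ltn_ord l')) // ll addnS.
  apply: iff_trans (IH (Ordinal ln) erefl) _.
  apply: iff_trans (Qpiece _ (inr (inr (inord K)))) _.
  apply: iff_trans (iff_sym (Qpiece _ (inl false))).
  by apply: iffQ => //; apply: touch_next_B; rewrite ll addnS.
have Qt : Q (piece a t i (inl true)).
  apply: st (Qhub (widen_ord (leqnSn G) a)) => //; exact: touch_hub_A.
apply/Qpiece; have [tj|jt] := leqP t j.
  by apply/(QA (j - t)%N t j); rewrite ?subnKC.
by apply/(QA (t - j)%N j t); rewrite ?subnKC // ltnW.
Qed.

Lemma cross_disj (t t' : 'I_k) v : cross t v -> cross t' v -> t = t'.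
Proof.
case: v => [[[a j] /= -> //|[[[a j] i] p] /= h h']|//].
by apply: ord_inj; rewrite -h.
Qed.

Lemma cross_meet (t t' : 'I_k) : k = (G * g)%N ->
  exists u v, [/\ cross t u, cross t' v & touch u v].
Proof.
move=> kE; have tk : (t' < G * g)%N by rewrite -kE.
have g0 : (0 < g)%N by case: (posnP g) tk => // ->; rewrite muln0.
have aG : (t' %/ g < G)%N by rewrite ltn_divLR.
have ig : (t' %% g < g)%N by rewrite ltn_mod.
exists (hub (widen_ord (leqnSn G) (Ordinal aG)) t).
exists (piece (Ordinal aG) t (Ordinal ig) (inl true)); split => //=.
  by rewrite -divn_eq.
exact: touch_hub_A.
Qed.

(** A piece is reached from the huge ball through the column in which it lies, in general not column
    [t], and then through the [A] next to it; hence the bound is independent of the number of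
    columns. *)
Lemma cross_dist (lam : vertices -> nat) :
  (forall u v, touch u v -> (lam u <= (lam v).+1)%N) -> forall t v, cross t v ->
  (lam v <= lam None + (G + 2 * K + 6))%N && (lam None <= lam v + (G + 2 * K + 6))%N.
Proof.
move=> lip t.
pose P n v := (lam v <= lam None + n)%N && (lam None <= lam v + n)%N.
have Pst n u v : touch u v -> P n u -> P n.+1 v.
  move=> e; have h1 := lip _ _ e; have h2 : (lam v <= (lam u).+1)%N.
    by apply: lip; rewrite touch_sym.
  by rewrite /P; lia.
have Phub (a : 'I_G.+1) j : P a.+1 (hub a j).
  case: a => a; elim: a => [|a IH] aG.
    rewrite (_ : Ordinal aG = ord0); last by apply: ord_inj.
    by apply: Pst (touch_top j) _; rewrite /P addn0 leqnn.
  by apply: Pst (IH (ltnW aG)); apply: touch_hub_hub.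
have Pmon n n' v : (n <= n')%N -> P n v -> P n' v by rewrite /P; lia.
case=> [[[a j] _|[[[a j] i] p] _]|//].
  by apply: Pmon (Phub a j); have := ltn_ord a; lia.
have PA : P a.+2 (piece a j i (inl true)).
  by apply: Pst (Phub (widen_ord (leqnSn G) a) j); apply: touch_hub_A.
have [l ln] := @wire_steps a j i P a.+2 (fun n _ _ => @Pst n _ _) PA p.
by apply: Pmon; have := ltn_ord a; lia.
Qed.

Definition contact_graph := SGraph touch_sym touch_irr.

Lemma contact_graph_order (H : sgraph) l w : k = (G * g)%N -> treewidth_le H w ->
  subgraph contact_graph (strong_product H (path_graph l)) ->
  (k <= w.+1 * (G + 2 * K + 6).*2.+1)%N.
Proof.
move=> kE tw sub.
apply: (product_order_bound (D := None : contact_graph) (Y := cross)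
  (root := hub ord0) tw sub) => //.
- exact: cross_ind.
- by move=> t t' _; exact: cross_meet.
- by move=> t t' v; exact: cross_disj.
- exact: cross_dist.
Qed.

Lemma packing_spec : [/\ forall v, 0 < vr v,
  forall v u, v <> u -> core_free v u &
  forall (H : sgraph) l w, k = (G * g)%N -> treewidth_le H w ->
    subgraph contact_graph (strong_product H (path_graph l)) ->
    (k <= w.+1 * (G + 2 * K + 6).*2.+1)%N].
Proof.
by split; [exact: vr_gt0|exact: vertices_core_free|exact: contact_graph_order].
Qed.

End Packing.

(** * Area under homotheties and rotations *)

Section Area.
Variable R : realType.
Local Notation lam := (@lebesgue_measure R).

Lemma measurable_affine (s b : R) :
  measurable_fun [set: measurableTypeR R] (fun x : R => s * x + b : measurableTypeR R).
Proof. by apply: measurable_funD => //; apply: measurable_funM. Qed.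

(** The pushforward scaled by [s] agrees with Lebesgue measure on intervals, which determine it. *)
Lemma lebesgue_affine (s b : R) (A : set (measurableTypeR R)) : 0 < s -> measurable A ->
  lam A = (s%:E * lam ((fun x : R => s * x + b)%R @^-1` A))%E.
Proof.
move=> s0 mA.
have s0' : 0 <= s by apply: ltW.
have mf := measurable_affine s b.
pose f (x : measurableTypeR R) : measurableTypeR R := s * x + b.
apply: (lebesgue_measure_unique (mu := mscale (NngNum s0') (pushforward lam f))) => //.
move=> _ [[x y] _ <-] /=; rewrite /mscale /= /pushforward.
rewrite (_ : _ @^-1` _ = `](x - b) / s, (y - b) / s]%classic); last first.
  apply/seteqP; split => z /=; rewrite !in_itv /= ltr_pdivrMr // ler_pdivlMr //;
  by rewrite ltrBlDr lerBrDr mulrC.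
rewrite !lebesgue_measure_itv /= !lte_fin ltr_pM2r ?invr_gt0 // ltrD2r.
case: ifP => _; last by rewrite mule0.
by rewrite -!EFinB -EFinM; congr (_%:E); field; rewrite gt_eqF.
Qed.

Lemma area_cross_affine (s b d : R) (X : set (R * R)) : 0 < s -> measurable X ->
  area X = ((s * s)%:E * area ((fun p => (s * p.1 + b, s * p.2 + d))%R @^-1` X))%E.
Proof.
move=> s0 mX; have s0' : 0 <= s * s by rewrite mulr_ge0 // ltW.
pose f (p : measurableTypeR R * measurableTypeR R) :
  measurableTypeR R * measurableTypeR R := (s * p.1 + b, s * p.2 + d).
have mf : measurable_fun [set: measurableTypeR R * measurableTypeR R] f.
  by apply/measurable_fun_pairP; split; apply: measurable_funD => //;
    apply: measurable_funM.
apply: (product_measure_unique (m' := mscale (NngNum s0') (pushforward (lam \x lam)%E f))) => //.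
move=> A B mA mB; rewrite /= /mscale /= /pushforward /=.
rewrite (_ : _ @^-1` _ = ((fun x => s * x + b) @^-1` A) `*` ((fun x => s * x + d) @^-1` B)) //.
rewrite product_measure1E; last 2 first.
- by rewrite -[X in measurable X]setTI; apply: measurable_affine.
- by rewrite -[X in measurable X]setTI; apply: measurable_affine.
rewrite (lebesgue_affine b s0 mA) (lebesgue_affine d s0 mB).
by rewrite EFinM -!muleA; congr (_ * _)%E; rewrite muleCA.
Qed.

Lemma measurable_affine2 (a b c d e f : R) : measurable_fun
  [set: measurableTypeR R * measurableTypeR R]
  (fun p : R * R => (a * p.1 + b * p.2 + c, d * p.1 + e * p.2 + f)
     : measurableTypeR R * measurableTypeR R).
Proof.
by apply/measurable_fun_pairP; split; apply: measurable_funD => //;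
  apply: measurable_funD => //; apply: measurable_funM.
Qed.

Lemma measurable_halfplane (a b c : R) :
  measurable ([set p | a * p.1 + b * p.2 <= c] : set (measurableTypeR R * measurableTypeR R)).
Proof.
rewrite (_ : [set p | _] =
    (fun p : measurableTypeR R * measurableTypeR R => a * p.1 + b * p.2 : measurableTypeR R)
      @^-1` `]-oo, c]); last by apply/seteqP; split => p /=; rewrite in_itv.
rewrite -[X in measurable X]setTI.
suff mf : measurable_fun setT (fun p : measurableTypeR R * measurableTypeR R =>
  a * p.1 + b * p.2 : measurableTypeR R) by apply: mf.
by apply: measurable_funD => //; apply: measurable_funM.
Qed.

Lemma homothety_preimage (s : R) (b : R * R) (S : set (R * R)) : s != 0 ->
  [set (s * p.1 + b.1, s * p.2 + b.2) | p in S] =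
  (fun p : R * R => (s^-1 * p.1 + 0 * p.2 + - (s^-1 * b.1),
     0 * p.1 + s^-1 * p.2 + - (s^-1 * b.2))) @^-1` S.
Proof.
move=> s0; apply/seteqP; split => [_ [p Sp <-] /=|p /= Sp].
  by rewrite !mul0r addr0 add0r !mulrDr !mulKf // !addrK -surjective_pairing.
exists (s^-1 * p.1 - s^-1 * b.1, s^-1 * p.2 - s^-1 * b.2).
  by move: Sp; rewrite !mul0r addr0 add0r.
by rewrite /= !mulrBr !mulVKf // !subrK -surjective_pairing.
Qed.

Lemma measurable_homothety (s : R) (b : R * R) (S : set (R * R)) : s != 0 ->
  measurable (S : set (measurableTypeR R * measurableTypeR R)) ->
  measurable ([set (s * p.1 + b.1, s * p.2 + b.2) | p in S]
    : set (measurableTypeR R * measurableTypeR R)).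
Proof.
move=> s0 mS; rewrite homothety_preimage // -[X in measurable X]setTI.
exact: measurable_affine2.
Qed.

Lemma area_homothety (s : R) (b : R * R) (S : set (R * R)) : 0 < s ->
  measurable (S : set (measurableTypeR R * measurableTypeR R)) ->
  area [set (s * p.1 + b.1, s * p.2 + b.2) | p in S] = ((s * s)%:E * area S)%E.
Proof.
move=> s0 mS; have sn : s != 0 by rewrite gt_eqF.
rewrite (area_cross_affine b.1 b.2 s0); last exact: measurable_homothety.
congr (_ * area _)%E; apply/seteqP; split => p /=.
  case=> q Sq [] /addIr /(mulfI sn) e1 /addIr /(mulfI sn) e2.
  by case: p q e1 e2 Sq => p1 p2 [q1 q2] /= -> ->.
by move=> Sp; exists p.
Qed.

(** Fubini: every vertical section is only translated. *)
Lemma area_shear_y (t d : R) (X : set (R * R)) :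
  measurable (X : set (measurableTypeR R * measurableTypeR R)) ->
  area X = area ((fun p => (p.1, p.2 + (t * p.1 + d))) @^-1` X).
Proof.
move=> mX; rewrite /area /product_measure1; apply: eq_integral => x _ /=.
have mXx : measurable (xsection X x) by exact: measurable_xsection.
rewrite (lebesgue_affine (t * x + d) ltr01 mXx) mul1e; congr (lam _).
by apply/seteqP; split => y; rewrite /= /xsection /= !inE /= mul1r.
Qed.

Lemma area_swap (X : set (R * R)) :
  measurable (X : set (measurableTypeR R * measurableTypeR R)) ->
  area X = (lam \x^ lam)%E X.
Proof.
move=> mX; apply: (product_measure_unique (m' := (lam \x^ lam)%E)) => // A B mA mB.
exact: product_measure2E.
Qed.

Lemma area_shear_x (t d : R) (X : set (R * R)) :
  measurable (X : set (measurableTypeR R * measurableTypeR R)) ->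
  area X = area ((fun p => (p.1 + (t * p.2 + d), p.2)) @^-1` X).
Proof.
move=> mX; rewrite !area_swap //; last first.
  rewrite -[X in measurable X]setTI.
  have := measurable_affine2 1 t d 0 1 0; rewrite (_ : (fun p => _) =
     (fun p : R * R => (p.1 + (t * p.2 + d), p.2))); first by apply.
  by apply/funext => p; rewrite !mul1r mul0r add0r addr0 addrA.
rewrite /product_measure2; apply: eq_integral => y _ /=.
have mXy : measurable (ysection X y) by exact: measurable_ysection.
rewrite (lebesgue_affine (t * y + d) ltr01 mXy) mul1e; congr (lam _).
by apply/seteqP; split => x; rewrite /= /ysection /= !inE /= mul1r.
Qed.

Lemma measurable_shear (f : R * R -> R * R) (X : set (R * R)) :
  (exists a b c d e h, f = fun p : R * R => (a * p.1 + b * p.2 + c, d * p.1 + e * p.2 + h)) ->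
  measurable (X : set (measurableTypeR R * measurableTypeR R)) ->
  measurable (f @^-1` X : set (measurableTypeR R * measurableTypeR R)).
Proof.
move=> [a [b [c [d [e [h ->]]]]]] mX; rewrite -[X in measurable X]setTI.
exact: measurable_affine2.
Qed.

Definition rotation (phi : R) (c p : R * R) : R * R :=
  (c.1 + ((p.1 - c.1) * cos phi - (p.2 - c.2) * sin phi),
   c.2 + ((p.1 - c.1) * sin phi + (p.2 - c.2) * cos phi)).

(* A rotation is a product of three shears. *)
Lemma area_rotation (phi : R) (c : R * R) (X : set (R * R)) : sin phi != 0 ->
  measurable (X : set (measurableTypeR R * measurableTypeR R)) ->
  area X = area (rotation phi c @^-1` X).
Proof.
(* [t] is the tangent of [phi / 2]; the outer two shears are horizontal with factor [- t], the
   middle one is vertical with factor [sin phi]. *)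
move=> s0 mX; pose t := (1 - cos phi) / sin phi.
pose f (p : R * R) := (p.1 + (- t * p.2 + t * c.2), p.2).
pose g (p : R * R) := (p.1, p.2 + (sin phi * p.1 + - (sin phi * c.1))).
have mf Y : measurable (Y : set (measurableTypeR R * measurableTypeR R)) ->
    measurable (f @^-1` Y : set (measurableTypeR R * measurableTypeR R)).
  apply: measurable_shear; exists 1, (- t), (t * c.2), 0, 1, 0.
  by apply/funext => p; rewrite /f !mul1r mul0r add0r addr0 addrA.
have mg Y : measurable (Y : set (measurableTypeR R * measurableTypeR R)) ->
    measurable (g @^-1` Y : set (measurableTypeR R * measurableTypeR R)).
  apply: measurable_shear; exists 1, 0, 0, (sin phi), 1, (- (sin phi * c.1)).
  by apply/funext => p; rewrite /g; congr (_, _); ring.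
have := area_shear_x (- t) (t * c.2) mX; rewrite -/f => ->.
have := area_shear_y (sin phi) (- (sin phi * c.1)) (mf _ mX); rewrite -/g => ->.
have := area_shear_x (- t) (t * c.2) (mg _ (mf _ mX)); rewrite -/f => ->.
have ts : t * sin phi = 1 - cos phi by rewrite /t divfK.
have tc : t * (1 + cos phi) = sin phi.
  apply: (mulIf s0); rewrite mulrAC ts -expr2 sin2cos2; ring.
have fgf p : f (g (f p)) = rotation phi c p.
  rewrite /f /g /rotation /=; congr (_, _); last first.
    rewrite (_ : _ + _ = c.2 + ((p.1 - c.1) * sin phi + (p.2 - c.2) * (1 - t * sin phi)));
      last by ring.
    by rewrite ts; ring.
  rewrite (_ : _ + _ = c.1 + ((p.1 - c.1) * (1 - t * sin phi) -
    (p.2 - c.2) * (t * (1 + (1 - t * sin phi))))); last by ring.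
  by rewrite ts !opprB !(addrC 1) !subrK (addrC (cos phi)) tc.
by congr area; apply/seteqP; split => p /=; rewrite fgf.
Qed.

End Area.

(** * Regular polygons as balls of a norm *)

Section Polygon.
Variables (R : realType) (n : nat) (r theta : R).
Hypotheses (n_ge2 : (2 <= n)%N) (r_gt0 : 0 < r).

Definition omega : R := pi / n%:R.
(** In the affine coordinates used for the arrangement, the length of the two sides at the corner
    [(-1, -1)]; for the square it is [2]. *)
Definition sigma_n : R := 2 * (1 - cos omega).

(* [vert_pt t] is the vertex of index [t], and [face t] the linear form equal to 1
   on the side from [vert_pt t] to [vert_pt (t + 1)]; [t] ranges over the reals. *)
Definition vert_pt (t : R) : R * R :=
  (r * cos (theta + t * omega), r * sin (theta + t * omega)).
Definition face (t : R) (z : R * R) : R :=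
  (z.1 * cos (theta + (t + 2^-1) * omega) + z.2 * sin (theta + (t + 2^-1) * omega))
    / (r * cos (omega / 2)).

Let n_gt0 : 0 < n%:R :> R. Proof. by rewrite ltr0n; lia. Qed.

Lemma n_omega : n%:R * omega = pi.
Proof. by rewrite /omega mulrC divfK // gt_eqF. Qed.

Lemma omega_bnd : 0 < omega <= pi / 2.
Proof.
rewrite divr_gt0 ?pi_gt0 //= /omega ler_wpM2l ?pi_ge0 // lef_pV2 ?posrE //.
by rewrite ler_nat.
Qed.

Lemma cos_half_gt0 : 0 < cos (omega / 2).
Proof.
have /andP[w0 w1] := omega_bnd; have p0 := @pi_gt0 R.
by apply: cos_gt0_pihalf; apply/andP; split; lra.
Qed.

Lemma sin_omega_gt0 : 0 < sin omega.
Proof.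
have /andP[w0 w1] := omega_bnd; have p0 := @pi_gt0 R.
by apply: sin_gt0_pi; apply/andP; split; lra.
Qed.

Lemma cos_omega_ge0 : 0 <= cos omega.
Proof.
have /andP[w0 w1] := omega_bnd; have p0 := @pi_gt0 R.
by apply: cos_ge0_pihalf; apply/andP; split; lra.
Qed.

Lemma cos_omega_lt1 : cos omega < 1.
Proof.
rewrite lt_neqAle cos_le1 andbT; apply/eqP => c1.
have : 0 < sin omega ^+ 2 by rewrite exprn_gt0 // sin_omega_gt0.
by have := cos2Dsin2 omega; rewrite c1 expr1n; lra.
Qed.

Lemma sigma_n_bnd : 0 < sigma_n <= 2.
Proof.
have h1 := cos_omega_ge0; have h2 := cos_omega_lt1; rewrite /sigma_n.
by apply/andP; split; lra.
Qed.

Let rc : r * cos (omega / 2) != 0.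
Proof. by rewrite gt_eqF // mulr_gt0 // cos_half_gt0. Qed.

Lemma face_vert t s : face t (vert_pt s) =
  cos ((s - t - 2^-1) * omega) / cos (omega / 2).
Proof.
rewrite /face /vert_pt /=.
have -> : (s - t - 2^-1) * omega = (theta + s * omega) - (theta + (t + 2^-1) * omega) by ring.
rewrite cosB; field.
by rewrite !gt_eqF ?cos_half_gt0.
Qed.

Lemma face_vert0 t : face t (vert_pt t) = 1.
Proof.
rewrite face_vert; have -> : (t - t - 2^-1) * omega = - (omega / 2) by field.
by rewrite cosN divff // gt_eqF // cos_half_gt0.
Qed.

Lemma face_vert1 t : face t (vert_pt (t + 1)) = 1.
Proof.
rewrite face_vert; have -> : (t + 1 - t - 2^-1) * omega = omega / 2 by field.
by rewrite divff // gt_eqF // cos_half_gt0.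
Qed.

Lemma cos_three_half : cos (3 * (omega / 2)) = (1 - sigma_n) * cos (omega / 2).
Proof.
have h := cos2Dsin2 (omega / 2).
have c1 : cos omega = cos (omega / 2) ^+ 2 - sin (omega / 2) ^+ 2.
  by rewrite {1}(_ : omega = omega / 2 + omega / 2) ?cosD ?expr2 //; field.
have -> : 3 * (omega / 2) = omega / 2 + omega / 2 + omega / 2 by field.
rewrite /sigma_n c1 !cosD sinD; set a := cos _ in h *; set b := sin _ in h *.
rewrite (_ : _ - _ = a ^+ 3 - 3 * a * b ^+ 2); last by ring.
by rewrite (_ : b ^+ 2 = 1 - a ^+ 2); [ring|lra].
Qed.

Lemma face_vert2 t : face t (vert_pt (t + 2)) = 1 - sigma_n.
Proof.
rewrite face_vert; have -> : (t + 2 - t - 2^-1) * omega = 3 * (omega / 2) by field.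
by rewrite cos_three_half mulfK // gt_eqF // cos_half_gt0.
Qed.

Lemma face_vertN1 t : face t (vert_pt (t - 1)) = 1 - sigma_n.
Proof.
rewrite face_vert; have -> : (t - 1 - t - 2^-1) * omega = - (3 * (omega / 2)) by field.
by rewrite cosN cos_three_half mulfK // gt_eqF // cos_half_gt0.
Qed.

Lemma face_rec t z : face (t + 1) z + face (t - 1) z = (2 - sigma_n) * face t z.
Proof.
rewrite /face -mulrDl [RHS]mulrA; congr (_ / _).
have -> : theta + (t + 1 + 2^-1) * omega = (theta + (t + 2^-1) * omega) + omega by ring.
have -> : theta + (t - 1 + 2^-1) * omega = (theta + (t + 2^-1) * omega) - omega by ring.
by set A := theta + _; rewrite (cosD A) (sinD A) (cosB A) (sinB A) /sigma_n; ring.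
Qed.

Lemma face_opp t z : face (t + n%:R) z = - face t z.
Proof.
rewrite /face; have -> : theta + (t + n%:R + 2^-1) * omega =
  (theta + (t + 2^-1) * omega) + pi by rewrite -n_omega; ring.
by rewrite cosDpi sinDpi; ring.
Qed.

Lemma face_lin t a b z w :
  face t (a * z.1 + b * w.1, a * z.2 + b * w.2) = a * face t z + b * face t w.
Proof. by rewrite /face /=; ring. Qed.

Lemma face_eq t z w : face t z = face t w -> face (t + 1) z = face (t + 1) w -> z = w.
Proof.
move=> h0 h1.
have {}h0 : face t (z.1 - w.1, z.2 - w.2) = 0.
  by have := face_lin t 1 (-1) z w; rewrite !mul1r !mulN1r => ->; rewrite h0 subrr.
have {}h1 : face (t + 1) (z.1 - w.1, z.2 - w.2) = 0.
  by have := face_lin (t + 1) 1 (-1) z w; rewrite !mul1r !mulN1r => ->; rewrite h1 subrr.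
move: h0 h1; rewrite /face /=.
have -> : theta + (t + 1 + 2^-1) * omega = (theta + (t + 2^-1) * omega) + omega by ring.
set A := theta + _; rewrite (cosD A) (sinD A).
set x := z.1 - w.1; set y := z.2 - w.2.
move=> /eqP; rewrite mulf_eq0 invr_eq0 (negbTE rc) orbF => /eqP h0.
move=> /eqP; rewrite mulf_eq0 invr_eq0 (negbTE rc) orbF => /eqP h1.
have so : sin omega != 0 by rewrite gt_eqF // sin_omega_gt0.
have h2 : - x * sin A + y * cos A = 0.
  apply: (mulIf so); rewrite mul0r -[RHS]h1.
  have : (x * cos A + y * sin A) * cos omega = 0 by rewrite h0 mul0r.
  by move=> e; apply/eqP; rewrite -subr_eq0; apply/eqP; rewrite -[RHS]oppr0 -e; ring.
have h3 := cos2Dsin2 A.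
have x0 : x = 0.
  have -> : x = (x * cos A + y * sin A) * cos A - (- x * sin A + y * cos A) * sin A.
    by rewrite -{1}[x]mulr1 -h3; ring.
  by rewrite h0 h2 !mul0r subr0.
have y0 : y = 0.
  have -> : y = (x * cos A + y * sin A) * sin A + (- x * sin A + y * cos A) * cos A.
    by rewrite -{1}[y]mulr1 -h3; ring.
  by rewrite h0 h2 !mul0r addr0.
by case: z w @x @y x0 y0 {h0 h1 h2} => z1 z2 [w1 w2] /= /eqP + /eqP;
  rewrite !subr_eq0 => /eqP -> /eqP ->.
Qed.

(** The [2 * n] sides come in opposite pairs, so [n] forms with absolute values suffice; the even
    number of corners is what makes the polygon the ball of a norm. *)
Definition pnorm (z : R * R) : R := \big[Num.max/0]_(k < n) `|face k%:R z|.

Lemma pnorm_ge0 z : 0 <= pnorm z.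
Proof. exact: bigmax_ge_id. Qed.

Lemma face_le_pnorm (k : nat) z : `|face k%:R z| <= pnorm z.
Proof.
elim/ltn_ind: k => k IH; have [kn|nk] := ltnP k n.
  exact: (le_bigmax _ (fun i : 'I_n => `|face i%:R z|) (Ordinal kn)).
by rewrite -(subnK nk) natrD face_opp normrN IH //; lia.
Qed.

Lemma pnorm_le z s : 0 <= s -> (forall k : nat, face k%:R z <= s) -> pnorm z <= s.
Proof.
move=> s0 h; apply: bigmax_le => // i _; rewrite ler_norml h andbT.
by have := h (i + n)%N; rewrite natrD face_opp lerNl.
Qed.

Lemma pnorm_tri z w : pnorm (z.1 + w.1, z.2 + w.2) <= pnorm z + pnorm w.
Proof.
apply: pnorm_le => [|k]; first by rewrite addr_ge0 ?pnorm_ge0.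
have := face_lin k%:R 1 1 z w; rewrite !mul1r => ->.
by apply: lerD; apply: le_trans (ler_norm _) (face_le_pnorm _ _).
Qed.

Lemma face_scale t a z : face t (a * z.1, a * z.2) = a * face t z.
Proof. by rewrite /face /=; ring. Qed.

Lemma pnorm_scale_le a z : pnorm (a * z.1, a * z.2) <= `|a| * pnorm z.
Proof.
apply: pnorm_le => [|k]; first by rewrite mulr_ge0 ?pnorm_ge0.
rewrite face_scale; apply: le_trans (ler_norm _) _; rewrite normrM.
by rewrite ler_wpM2l // face_le_pnorm.
Qed.

Lemma pnorm_scale a z : pnorm (a * z.1, a * z.2) = `|a| * pnorm z.
Proof.
have [->|a0] := eqVneq a 0.
  rewrite normr0 [RHS]mul0r; apply/eqP; rewrite eq_le pnorm_ge0 andbT.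
  by have := pnorm_scale_le 0 z; rewrite normr0 [leRHS]mul0r.
apply/eqP; rewrite eq_le pnorm_scale_le /=.
have := pnorm_scale_le a^-1 (a * z.1, a * z.2); rewrite /= !mulKf // -surjective_pairing.
by rewrite normfV ler_pdivlMl // normr_gt0.
Qed.

Lemma cos_le_half (l : nat) : `|cos ((l%:R + 2^-1) * omega)| <= cos (omega / 2).
Proof.
elim/ltn_ind: l => l IH; have [ln|nl] := ltnP l n; last first.
  rewrite -(subnK nl) natrD.
  have -> : ((l - n)%:R + n%:R + 2^-1) * omega =
    ((l - n)%:R + 2^-1) * omega + pi by rewrite -n_omega; ring.
  by rewrite cosDpi normrN IH //; lia.
have /andP[w0 w1] := omega_bnd; have p0 := @pi_gt0 R.
(* The angle is [a + b] and [omega / 2] is [a - b]. Since [a] and [b] lie between [0] and [pi / 2],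
   both products in the addition formulas are nonnegative, and the bound follows. *)
pose a := (l%:R + 1) * omega / 2; pose b := l%:R * omega / 2.
have -> : (l%:R + 2^-1) * omega = a + b by rewrite /a /b; field.
have -> : omega / 2 = a - b by rewrite /a /b; field.
have b0 : 0 <= b by rewrite /b !mulr_ge0 // ltW.
have ab : b <= a by rewrite /a /b; lra.
have a1 : a <= pi / 2.
  rewrite /a ler_pM2r ?invr_gt0 // -n_omega ler_pM2r // natr1 ler_nat //.
have ca : 0 <= cos a by apply: cos_ge0_pihalf; apply/andP; split; lra.
have cb : 0 <= cos b by apply: cos_ge0_pihalf; apply/andP; split; lra.
have sa : 0 <= sin a by apply: sin_ge0_pi; apply/andP; split; lra.
have sb : 0 <= sin b by apply: sin_ge0_pi; apply/andP; split; lra.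
rewrite ler_norml (cosB a b) (cosD a b).
have := mulr_ge0 ca cb; have := mulr_ge0 sa sb.
by move=> h1 h2; apply/andP; split; lra.
Qed.

Lemma face_vert_le (k j : nat) : face k%:R (vert_pt j%:R) <= 1.
Proof.
rewrite face_vert ler_pdivrMr ?cos_half_gt0 // mul1r.
apply: le_trans (ler_norm _) _.
have [kj|jk] := ltnP k j.
  have -> : (j%:R - k%:R - 2^-1) * omega = ((j - k.+1)%:R + 2^-1) * omega.
    by rewrite natrB // -natr1; field.
  exact: cos_le_half.
have -> : (j%:R - k%:R - 2^-1) * omega = - (((k - j)%:R + 2^-1) * omega).
  by rewrite natrB //; field.
by rewrite cosN; exact: cos_le_half.
Qed.

Lemma pnorm_vert (j : nat) : pnorm (vert_pt j%:R) <= 1.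
Proof. by apply: pnorm_le => // k; exact: face_vert_le. Qed.

(** * The polygon and the hull of four corners as intersections of half-planes *)

Lemma convex_pair (A : set (R * R)) (x y : R * R) (t : R) :
  convex_set (A : set (R^o * R^o)) -> A x -> A y -> 0 <= t -> t <= 1 ->
  A (t * x.1 + (1 - t) * y.1, t * x.2 + (1 - t) * y.2).
Proof.
move=> cA Ax Ay t0 t1.
have := cA x y (Itv01 t0 t1); rewrite !inE => /(_ Ax Ay).
by case: x {Ax} => x1 x2; case: y {Ay}.
Qed.

Lemma face_convex (t s : R) (c : R * R) :
  convex_set ([set z | face t (z.1 - c.1, z.2 - c.2) <= s] : set (R^o * R^o)).
Proof.
move=> x y l; rewrite !inE /= => hx hy.
have l0 : 0 <= l%:num by []. have l1 : 0 <= 1 - l%:num by rewrite subr_ge0.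
rewrite (_ : (_, _) = (l%:num * (x.1 - c.1) + (1 - l%:num) * (y.1 - c.1),
    l%:num * (x.2 - c.2) + (1 - l%:num) * (y.2 - c.2))); last first.
  by congr (_, _); rewrite /unstable.onem /GRing.scale /=; ring.
have := face_lin t l%:num (1 - l%:num) (x.1 - c.1, x.2 - c.2) (y.1 - c.1, y.2 - c.2).
move=> /= ->; have h1 := ler_wpM2l l0 hx; have h2 := ler_wpM2l l1 hy; lra.
Qed.

Lemma face_per t z : face (t + n%:R + n%:R) z = face t z.
Proof. by rewrite !face_opp opprK. Qed.

Lemma vert_opp t : vert_pt (t + n%:R) = (- (vert_pt t).1, - (vert_pt t).2).
Proof.
rewrite /vert_pt; have -> : theta + (t + n%:R) * omega = theta + t * omega + pi.
  by rewrite -n_omega; ring.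
by rewrite cosDpi sinDpi !mulrN.
Qed.

Lemma vert_per t : vert_pt (t + n%:R + n%:R) = vert_pt t.
Proof. by rewrite !vert_opp /= !opprK. Qed.

Lemma corner_vert c k : corner (2 * n) c r theta k =
  (c.1 + (vert_pt k%:R).1, c.2 + (vert_pt k%:R).2).
Proof.
rewrite /corner /vert_pt /=.
have -> // : pi *+ 2 * k%:R / (2 * n)%:R = k%:R * omega.
by rewrite /omega natrM -mulr_natl; field; rewrite gt_eqF.
Qed.

Lemma face_vert_convex_sub N' m c t s : (forall k, (k < m)%N ->
    face t ((corner N' c r theta k).1 - c.1, (corner N' c r theta k).2 - c.2) <= s) ->
  forall z, corner_hull N' m c r theta z -> face t (z.1 - c.1, z.2 - c.2) <= s.
Proof.
move=> h z; rewrite /corner_hull /convex_hull => /(_ _ (conj (@face_convex t s c) _)).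
by apply=> _ [k km <-]; exact: h.
Qed.

Lemma hull_face m c (k : nat) z : corner_hull (2 * n) m c r theta z ->
  face k%:R (z.1 - c.1, z.2 - c.2) <= 1.
Proof.
apply: face_vert_convex_sub => j _; rewrite corner_vert /= ![_ + (vert_pt _).1]addrC.
by rewrite ![_ + (vert_pt _).2]addrC !addrK -surjective_pairing face_vert_le.
Qed.

Lemma hull_pnorm m c z : corner_hull (2 * n) m c r theta z ->
  pnorm (z.1 - c.1, z.2 - c.2) <= 1.
Proof. by move=> h; apply: pnorm_le => // k; exact: hull_face h. Qed.

(* A point of the polygon lies in the cone spanned by the side whose face form is
   largest at it. *)
Lemma polygon_pnorm c : regular_polygon (2 * n) c r theta =
  [set z | pnorm (z.1 - c.1, z.2 - c.2) <= 1].
Proof.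
apply/seteqP; split => [z|z /= hz]; first exact: hull_pnorm.
have /andP[s0 _] := sigma_n_bnd.
move=> A [cA subA].
have VA (k : nat) : (k < 2 * n)%N ->
    A (c.1 + (vert_pt k%:R).1, c.2 + (vert_pt k%:R).2).
  by move=> kn; rewrite -corner_vert; apply: subA; exists k.
have VA' (k : nat) : (k <= 2 * n)%N ->
    A (c.1 + (vert_pt k%:R).1, c.2 + (vert_pt k%:R).2).
  rewrite leq_eqVlt => /orP[/eqP ->|]; last exact: VA.
  have := vert_per 0; rewrite add0r -natrD addnn -mul2n => ->.
  by apply: (VA 0%N); lia.
have cen : A c.
  have h0 : A (c.1 + (vert_pt 0).1, c.2 + (vert_pt 0).2) by apply: (VA 0%N); lia.
  have hn := VA n; have := vert_opp 0; rewrite add0r => vn.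
  have {}hn : A (c.1 - (vert_pt 0).1, c.2 - (vert_pt 0).2).
    by move: hn; rewrite vn; apply; lia.
  have half : 0 <= 2^-1 :> R by [].
  have half1 : 2^-1 <= 1 :> R by lra.
  have := convex_pair cA h0 hn half half1; congr (A _).
  by rewrite [RHS]surjective_pairing /=; congr (_, _); field.
pose w : R * R := (z.1 - c.1, z.2 - c.2).
have n2 : (0 < 2 * n)%N by lia.
case: (@arg_maxP _ _ _ (Ordinal n2) xpredT (fun k : 'I_(2 * n) => face k%:R w) isT).
move=> k _ kmax.
have kmaxN (j : nat) : face j%:R w <= face k%:R w.
  elim/ltn_ind: j => j IH; have [jn|nj] := ltnP j (2 * n)%N.
    exact: (kmax (Ordinal jn)).
  have {1}-> : j = (j - 2 * n + n + n)%N by lia.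
  by rewrite !natrD face_per; apply: IH; lia.
have kS := kmaxN k.+1; have kP : face (k%:R - 1) w <= face k%:R w.
  have := kmaxN (k + (2 * n).-1)%N.
  rewrite -(face_per (k%:R - 1)); congr (face _ _ <= _).
  have -> : (k + (2 * n).-1)%N = (k + n + n - 1)%N by lia.
  by rewrite natrB ?natrD; [ring|lia].
rewrite -natr1 in kS.
have M1 : face k%:R w <= 1.
  by apply: le_trans (ler_norm _) _; apply: le_trans (face_le_pnorm _ _) hz.
have M0 : 0 <= face k%:R w.
  by have := kmaxN (k + n)%N; rewrite natrD face_opp; lra.
set M := face k%:R w in M0 M1 kS kP.
(* The coordinates of [w] in the basis of corners [k] and [k + 1]: the next form takes the values
   [1 - sigma_n] and [1] there, so its value at [w] is [M - al * sigma_n]; symmetrically for [be]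
   and the previous form. *)
pose al := (M - face (k%:R + 1) w) / sigma_n.
pose be := (M - face (k%:R - 1) w) / sigma_n.
have al0 : 0 <= al by rewrite divr_ge0 ?subr_ge0 // ltW.
have be0 : 0 <= be by rewrite divr_ge0 ?subr_ge0 // ltW.
have abM : al + be = M.
  have := face_rec k%:R w; rewrite -/M => e.
  have -> : al + be = (2 * M - (face (k%:R + 1) w + face (k%:R - 1) w)) / sigma_n.
    by rewrite /al /be; ring.
  by rewrite e; field; rewrite gt_eqF.
have wE : w = (al * (vert_pt k%:R).1 + be * (vert_pt (k%:R + 1)).1,
               al * (vert_pt k%:R).2 + be * (vert_pt (k%:R + 1)).2).
  apply: (@face_eq k%:R); rewrite face_lin.
    by rewrite face_vert0 face_vert1 !mulr1 abM.
  have -> : face (k%:R + 1) (vert_pt k%:R) = 1 - sigma_n.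
    by have := face_vertN1 (k%:R + 1); rewrite addrK.
  rewrite face_vert0 mulr1 mulrBr mulr1 addrAC abM /al divfK ?gt_eqF //; ring.
have zE : z = (c.1 + w.1, c.2 + w.2) by rewrite /w /= !subrKC -surjective_pairing.
have [Me|Mne] := eqVneq M 0.
  have a0 : al = 0 by lra. have b0 : be = 0 by lra.
  by rewrite zE wE a0 b0 !mul0r /= !addr0 -surjective_pairing.
have Mp : 0 < M by rewrite lt_neqAle eq_sym Mne.
have Vk := VA k (ltn_ord k); have Vk1 := VA' k.+1 (ltn_ord k).
have t0 : 0 <= al / M by rewrite divr_ge0.
have t1 : al / M <= 1 by rewrite ler_pdivrMr // mul1r; lra.
have Ay := convex_pair cA Vk Vk1 t0 t1.
have := convex_pair cA Ay cen M0 M1; congr (A _).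
rewrite zE wE /= -natr1; have -> : be = M - al by lra.
by congr (_, _); field.
Qed.

Lemma half_hull_face c : corner_hull (2 * n) 4 c r theta =
  [set z | let w := (z.1 - c.1, z.2 - c.2) in
    [/\ face 0 w <= 1, face 1 w <= 1, face 2 w <= 1 & 1 - sigma_n <= face 1 w]].
Proof.
have /andP[s0 s2] := sigma_n_bnd.
have f13 : face 1 (vert_pt 3) = 1 - sigma_n.
  by rewrite -(face_vert2 1); congr (face _ (vert_pt _)); lra.
apply/seteqP; split => [z hz|z].
  split; [exact: (hull_face 0 hz)|exact: (hull_face 1 hz)|exact: (hull_face 2 hz)|].
  suff : face (1 + n%:R) (z.1 - c.1, z.2 - c.2) <= - (1 - sigma_n).
    by rewrite face_opp lerN2.
  apply: face_vert_convex_sub hz => k k4.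
  rewrite corner_vert /= ![_ + (vert_pt _).1]addrC ![_ + (vert_pt _).2]addrC.
  rewrite !addrK -surjective_pairing face_opp lerN2.
  case: k k4 => [|[|[|[|//]]]] _.
  - by have := face_vertN1 1; rewrite subrr => ->.
  - by rewrite face_vert0; lra.
  - by have := face_vert1 1; rewrite (_ : 1 + 1 = 2%:R) // => ->; lra.
  - by rewrite f13.
set w := (z.1 - c.1, z.2 - c.2) => /= -[f0 f1 f2 f3] A [cA subA].
have VA (k : nat) : (k < 4)%N ->
    A (c.1 + (vert_pt k%:R).1, c.2 + (vert_pt k%:R).2).
  by move=> kn; rewrite -corner_vert; apply: subA; exists k.
(* The hull is a trapezoid over the side [face 1 = 1]. [b] measures the height above that side, and
   [a] runs from [0] to [D] between the legs [face 0 = 1] and [face 2 = 1] at this height. [t]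
   locates the height on the legs, [u] the point between them. *)
pose a := 1 - face 0 w; pose b := 1 - face 1 w.
have e2 : face 2 w = (2 - sigma_n) * face 1 w - face 0 w.
  by rewrite -face_rec subrr addrK.
pose D := sigma_n + (2 - sigma_n) * b.
have D0 : 0 < D by rewrite /D ltr_pwDl // mulr_ge0 ?subr_ge0 // /b; lra.
have aD : a <= D by rewrite /a /D /b; move: f2; rewrite e2; lra.
pose t := b / sigma_n; pose u := a / D.
have t0 : 0 <= t by rewrite divr_ge0 ?(ltW s0) // /b; lra.
have t1 : t <= 1 by rewrite ler_pdivrMr // mul1r /b; lra.
have u0 : 0 <= u by rewrite divr_ge0 ?(ltW D0) // /a; lra.
have u1 : u <= 1 by rewrite ler_pdivrMr // mul1r.
have AL := convex_pair cA (VA 0%N isT) (VA 1%N isT) t0 t1.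
have AR := convex_pair cA (VA 3%N isT) (VA 2%N isT) t0 t1.
have := convex_pair cA AR AL u0 u1; congr (A _).
have wE : w = (u * (t * (vert_pt 3).1 + (1 - t) * (vert_pt 2).1) +
      (1 - u) * (t * (vert_pt 0).1 + (1 - t) * (vert_pt 1).1),
    u * (t * (vert_pt 3).2 + (1 - t) * (vert_pt 2).2) +
      (1 - u) * (t * (vert_pt 0).2 + (1 - t) * (vert_pt 1).2)).
  have f00 : face 0 (vert_pt 0) = 1 by rewrite face_vert0.
  have f01 : face 0 (vert_pt 1) = 1 by have := face_vert1 0; rewrite add0r.
  have f02 : face 0 (vert_pt 2) = 1 - sigma_n by have := face_vert2 0; rewrite add0r.
  have f10 : face 1 (vert_pt 0) = 1 - sigma_n by have := face_vertN1 1; rewrite subrr.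
  have f11 : face 1 (vert_pt 1) = 1 by rewrite face_vert0.
  have f12 : face 1 (vert_pt 2) = 1.
    by have := face_vert1 1; rewrite (_ : 1 + 1 = 2).
  have f23 : face 2 (vert_pt 3) = 1.
    by have := face_vert1 2; rewrite (_ : 2 + 1 = 3) //; ring.
  have f03 : face 0 (vert_pt 3) = (2 - sigma_n) * (1 - sigma_n) - 1.
    have := face_rec 1 (vert_pt 3); rewrite subrr f13 => <-.
    by rewrite (_ : 1 + 1 = 2) // f23; ring.
  apply: (@face_eq 0); rewrite ?add0r ?(face_lin _ u (1 - u) (_, _) (_, _)) ?(face_lin _ t (1 - t)).
    rewrite f00 f01 f02 f03.
    have uD : u * (sigma_n + (2 - sigma_n) * b) = a by rewrite /u divfK ?gt_eqF.
    have ts : t * sigma_n = b by rewrite /t divfK ?gt_eqF.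
    have fa : face 0 w = 1 - a by rewrite /a; ring.
    by rewrite fa -uD -ts; ring.
  rewrite f10 f11 f12 f13.
  have ts : t * sigma_n = b by rewrite /t divfK ?gt_eqF.
  have fb : face 1 w = 1 - b by rewrite /b; ring.
  by rewrite fb -ts; ring.
have -> : z = (c.1 + w.1, c.2 + w.2) by rewrite /w /= !subrKC -surjective_pairing.
by rewrite wE /=; congr (_, _); ring.
Qed.

(** * Affine coordinates adapted to one corner, and the balls in them *)

Definition dir1 : R * R := (((vert_pt 2).1 - (vert_pt 1).1) / sigma_n,
  ((vert_pt 2).2 - (vert_pt 1).2) / sigma_n).
Definition dir2 : R * R := (((vert_pt 0).1 - (vert_pt 1).1) / sigma_n,
  ((vert_pt 0).2 - (vert_pt 1).2) / sigma_n).

(* Affine coordinates in which the polygon is inscribed in the square [-1, 1]^2, two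
   consecutive sides lying on the left and on the bottom of the square. *)
Definition plane (x y : R) : R * R :=
  (x * dir1.1 + y * dir2.1, x * dir1.2 + y * dir2.2).

Let sigma_neq0 : sigma_n != 0.
Proof. by have /andP[s0 _] := sigma_n_bnd; rewrite gt_eqF. Qed.

Lemma face_vert12 : face 1 (vert_pt 2) = 1.
Proof. by have := face_vert1 1; rewrite (_ : 1 + 1 = 2). Qed.

Lemma face_vert02 : face 0 (vert_pt 2) = 1 - sigma_n.
Proof. by have := face_vert2 0; rewrite add0r. Qed.

Lemma face_vert01 : face 0 (vert_pt 1) = 1.
Proof. by have := face_vert1 0; rewrite add0r. Qed.

Lemma face_vert10 : face 1 (vert_pt 0) = 1 - sigma_n.
Proof. by have := face_vertN1 1; rewrite subrr. Qed.

Lemma face_dir t (v w : R * R) :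
  face t ((v.1 - w.1) / sigma_n, (v.2 - w.2) / sigma_n) = (face t v - face t w) / sigma_n.
Proof. by rewrite /face /=; ring. Qed.

Lemma face0_plane x y : face 0 (plane x y) = - x.
Proof.
rewrite /plane face_lin /dir1 /dir2 !face_dir face_vert02 face_vert01 face_vert0.
by rewrite subrr mul0r mulr0 addr0 addrAC subrr add0r mulNr divff // mulrN1.
Qed.

Lemma face1_plane x y : face 1 (plane x y) = - y.
Proof.
rewrite /plane face_lin /dir1 /dir2 !face_dir face_vert12 face_vert10 face_vert0.
by rewrite subrr mul0r mulr0 add0r addrAC subrr add0r mulNr divff // mulrN1.
Qed.

Lemma planeK z : plane (- face 0 z) (- face 1 z) = z.
Proof.
apply: (@face_eq 0); first by rewrite face0_plane opprK.
by rewrite add0r face1_plane opprK.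
Qed.

Lemma plane_add x y x' y' : plane (x + x') (y + y') =
  ((plane x y).1 + (plane x' y').1, (plane x y).2 + (plane x' y').2).
Proof. by rewrite /plane /=; congr (_, _); ring. Qed.

Lemma plane_scale a x y : plane (a * x) (a * y) = (a * (plane x y).1, a * (plane x y).2).
Proof. by rewrite /plane /=; congr (_, _); ring. Qed.

Definition gauge (x y : R) : R := pnorm (plane x y).

Lemma gauge_tri x y x' y' : gauge (x + x') (y + y') <= gauge x y + gauge x' y'.
Proof. by rewrite /gauge plane_add pnorm_tri. Qed.

Lemma gauge_hom t x y : gauge (t * x) (t * y) = `|t| * gauge x y.
Proof. by rewrite /gauge plane_scale pnorm_scale. Qed.

Lemma gauge_x x y : `|x| <= gauge x y.
Proof. by rewrite -normrN -(face0_plane x y); exact: (face_le_pnorm 0). Qed.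

Lemma gauge_y x y : `|y| <= gauge x y.
Proof. by rewrite -normrN -(face1_plane x y); exact: (face_le_pnorm 1). Qed.

Lemma gauge_opp x y : gauge (- x) (- y) = gauge x y.
Proof. by rewrite -[- x]mulN1r -[- y]mulN1r gauge_hom normrN1 mul1r. Qed.

Lemma gauge_vert (j : nat) : gauge (- face 0 (vert_pt j%:R)) (- face 1 (vert_pt j%:R)) <= 1.
Proof. by rewrite /gauge planeK pnorm_vert. Qed.

Lemma gauge_diag : gauge 1 1 <= 1.
Proof. by have := gauge_vert 1; rewrite face_vert01 face_vert0 gauge_opp. Qed.

Lemma gauge_left : gauge 1 (1 - sigma_n) <= 1.
Proof. by have := gauge_vert 0; rewrite face_vert10 face_vert0 gauge_opp. Qed.

Lemma gauge_bot : gauge (1 - sigma_n) 1 <= 1.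
Proof. by have := gauge_vert 2; rewrite face_vert02 face_vert12 gauge_opp. Qed.

Definition ball_at (x y s : R) : set (R * R) :=
  [set z | pnorm (z.1 - (plane x y).1, z.2 - (plane x y).2) <= s].

Lemma pnorm_gauge z x y : pnorm (z.1 - (plane x y).1, z.2 - (plane x y).2) =
  gauge (- face 0 z - x) (- face 1 z - y).
Proof.
rewrite /gauge (plane_add (- face 0 z) (- face 1 z)) planeK.
by congr (pnorm (_, _)); rewrite /plane /=; ring.
Qed.

Lemma in_ball x y s z :
  ball_at x y s z = (gauge (- face 0 z - x) (- face 1 z - y) <= s) :> Prop.
Proof. by rewrite -pnorm_gauge. Qed.

Lemma ball_gauge x y s x' y' s' z : ball_at x y s z -> ball_at x' y' s' z ->
  gauge (x - x') (y - y') <= s + s'.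
Proof.
rewrite !in_ball => h h'.
have -> : x - x' = - (- face 0 z - x) + (- face 0 z - x') by ring.
have -> : y - y' = - (- face 1 z - y) + (- face 1 z - y') by ring.
by apply: le_trans (gauge_tri _ _ _ _) _; rewrite gauge_opp lerD.
Qed.

Lemma ball_meet x y s x' y' s' : 0 < s -> 0 < s' ->
  ball_at x y s `&` ball_at x' y' s' !=set0 <-> gauge (x - x') (y - y') <= s + s'.
Proof.
move=> s0 s0'; split=> [[z []]|h]; first exact: ball_gauge.
have ss : 0 < s + s' by rewrite addr_gt0.
(* The common point divides the segment of the centres in the ratio of the radii. *)
pose t := s / (s + s').
have ts : t * (s + s') = s by rewrite /t divfK // gt_eqF.
have t0 : 0 <= t by rewrite divr_ge0 // ltW.
have t1 : 0 <= 1 - t.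
  by rewrite subr_ge0 /t ler_pdivrMr // mul1r lerDl ltW.
exists (plane (x - t * (x - x')) (y - t * (y - y'))); split; rewrite in_ball face0_plane face1_plane !opprK.
  have -> : x - t * (x - x') - x = - (t * (x - x')) by ring.
  have -> : y - t * (y - y') - y = - (t * (y - y')) by ring.
  by rewrite gauge_opp gauge_hom ger0_norm // -ts ler_wpM2l.
have -> : x - t * (x - x') - x' = (1 - t) * (x - x') by ring.
have -> : y - t * (y - y') - y' = (1 - t) * (y - y') by ring.
have -> : s' = (1 - t) * (s + s') by rewrite mulrBl ts; ring.
by rewrite gauge_hom ger0_norm // ler_wpM2l.
Qed.

Lemma ball_homothety c x y s : 0 < s -> ball_at x y s =
  [set (s * p.1 + ((plane x y).1 - s * c.1), s * p.2 + ((plane x y).2 - s * c.2))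
     | p in regular_polygon (2 * n) c r theta].
Proof.
move=> s0; have sn : s != 0 by rewrite gt_eqF.
rewrite polygon_pnorm; apply/seteqP; split=> [z hz|_ [p /= hp <-]]; last first.
  rewrite /ball_at /=.
  rewrite (_ : (_, _) = (s * (p.1 - c.1), s * (p.2 - c.2))); last by congr (_, _); ring.
  rewrite (pnorm_scale s (p.1 - c.1, p.2 - c.2)) ger0_norm ?(ltW s0) //.
  by rewrite -[leRHS]mulr1 ler_wpM2l // ltW.
exists (c.1 + s^-1 * (z.1 - (plane x y).1), c.2 + s^-1 * (z.2 - (plane x y).2)) => /=.
  rewrite ![_ + s^-1 * _]addrC !addrK.
  rewrite (pnorm_scale s^-1 (z.1 - (plane x y).1, z.2 - (plane x y).2)).
  by rewrite ger0_norm ?invr_ge0 ?(ltW s0) // ler_pdivrMl // mulr1.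
by case: z {hz} => z1 z2 /=; congr (_, _); rewrite mulrDr mulVKf //; ring.
Qed.

Lemma measurable_face t c b : measurable ([set z | face t (z.1 - c.1, z.2 - c.2) <= b]
  : set (measurableTypeR R * measurableTypeR R)).
Proof.
pose C := cos (theta + (t + 2^-1) * omega) / (r * cos (omega / 2)).
pose D := sin (theta + (t + 2^-1) * omega) / (r * cos (omega / 2)).
rewrite (_ : [set z | _] = [set z | C * z.1 + D * z.2 <= b + C * c.1 + D * c.2]).
  exact: measurable_halfplane.
apply/seteqP; split=> z /=; rewrite /face /= -/C mulrDl -!mulrA -/C -/D.
  lra.
lra.
Qed.

Lemma polygon_measurable c : measurable (regular_polygon (2 * n) c r theta
  : set (measurableTypeR R * measurableTypeR R)).
Proof.
rewrite polygon_pnorm (_ : [set z | _] = \bigcap_(k : nat)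
    [set z | face k%:R (z.1 - c.1, z.2 - c.2) <= 1]); last first.
  apply/seteqP; split=> [z /= hz k _|z hz] /=.
    by apply: le_trans (ler_norm _) _; apply: le_trans (face_le_pnorm _ _) hz.
  by apply: pnorm_le => // k; exact: (hz k I).
by apply: bigcapT_measurable => k; exact: measurable_face.
Qed.

Definition shrink_shift (c : R * R) (x y s k : R) : R * R :=
  ((plane x y).1 - s * (1 - k) * c.1 - s * k * (1 - sigma_n / 2) * (plane 1 1).1,
   (plane x y).2 - s * (1 - k) * c.2 - s * k * (1 - sigma_n / 2) * (plane 1 1).2).

(* The copy of [S] by which the ball at (x, y) of radius [s] contains the copy [S],
   shrunk by [1 - k] about an interior point near its lower left corner. *)
Definition shrunk c x y s k (S : set (R * R)) : set (R * R) :=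
  [set (s * (1 - k) * p.1 + (shrink_shift c x y s k).1,
        s * (1 - k) * p.2 + (shrink_shift c x y s k).2) | p in S].

Lemma face_shrunk t c x y s k (p : R * R) :
  face t (s * (1 - k) * p.1 + (shrink_shift c x y s k).1,
          s * (1 - k) * p.2 + (shrink_shift c x y s k).2) =
  s * (1 - k) * face t (p.1 - c.1, p.2 - c.2) + face t (plane x y)
    - s * k * (1 - sigma_n / 2) * face t (plane 1 1).
Proof. by rewrite /shrink_shift /face /=; ring. Qed.

(** In the unit ball the shrinking fixes the point with both coordinates [sigma_n / 2 - 1]. Its norm
    is at most [1 - sigma_n / 2], whence the radius [(1 - k) + k * (1 - sigma_n / 2)]. As both
    coordinates are [sigma_n / 2] below [sigma_n - 1], the hulls recede from their cutting lines by
    the same margin [k * sigma_n / 2]. *)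
Lemma shrunk_ball c x y s k p : 0 <= s -> 0 <= k <= 1 ->
  pnorm (p.1 - c.1, p.2 - c.2) <= 1 ->
  ball_at x y ((1 - k * sigma_n / 2) * s)
    (s * (1 - k) * p.1 + (shrink_shift c x y s k).1,
     s * (1 - k) * p.2 + (shrink_shift c x y s k).2).
Proof.
move=> s0 /andP[k0 k1] hp; have /andP[g0 g2] := sigma_n_bnd.
rewrite in_ball !face_shrunk !face0_plane !face1_plane.
set w := (_ - _, _ - _) in hp *.
have -> : - (s * (1 - k) * face 0 w - x - s * k * (1 - sigma_n / 2) * -1) - x =
   s * (1 - k) * - face 0 w + s * k * (1 - sigma_n / 2) * (- 1) by ring.
have -> : - (s * (1 - k) * face 1 w - y - s * k * (1 - sigma_n / 2) * -1) - y =
   s * (1 - k) * - face 1 w + s * k * (1 - sigma_n / 2) * (- 1) by ring.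
apply: le_trans (gauge_tri _ _ _ _) _; rewrite !gauge_hom (gauge_opp 1 1).
have a0 : 0 <= s * (1 - k) by rewrite mulr_ge0 // subr_ge0.
have b0 : 0 <= s * k * (1 - sigma_n / 2) by rewrite !mulr_ge0 //; lra.
have gw : gauge (- face 0 w) (- face 1 w) <= 1 by rewrite /gauge planeK.
rewrite !ger0_norm //; have h1 := ler_wpM2l a0 gw; have h2 := ler_wpM2l b0 gauge_diag.
lra.
Qed.

End Polygon.

(** * The lower and the left hull of four corners *)

Section HalfPolygon.
Variables (R : realType) (n : nat) (r theta : R) (c : R * R).
Hypotheses (n_ge2 : (2 <= n)%N) (r_gt0 : 0 < r).
Local Notation sigma := (sigma_n R n).
Local Notation phi := (omega R n).
Local Notation lower := (corner_hull (2 * n) 4 c r theta).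
Local Notation left := (corner_hull (2 * n) 4 c r (theta - phi)).

(** Lowering the phase by [phi] shifts the corner numbers by one, so [left] is the hull of the four
    corners around side [0], as [lower] is around side [1]. *)
Lemma face_turn t z : face n r (theta - phi) t z = face n r theta (t - 1) z.
Proof.
rewrite /face; have -> // : theta - phi + (t + 2^-1) * phi = theta + (t - 1 + 2^-1) * phi.
by ring.
Qed.

Lemma lower_pnorm z : lower z -> pnorm n r theta (z.1 - c.1, z.2 - c.2) <= 1.
Proof. exact: hull_pnorm. Qed.

Lemma left_pnorm z : left z -> pnorm n r theta (z.1 - c.1, z.2 - c.2) <= 1.
Proof.
move=> h; apply: pnorm_le => // k.
have := hull_face n_ge2 r_gt0 k.+1 h.
by rewrite face_turn -natr1 addrK.
Qed.

Lemma lower_face z : lower z -> 1 - sigma <= face n r theta 1 (z.1 - c.1, z.2 - c.2).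
Proof. by rewrite half_hull_face // => -[]. Qed.

Lemma left_face z : left z -> 1 - sigma <= face n r theta 0 (z.1 - c.1, z.2 - c.2).
Proof. by rewrite half_hull_face // => -[_ _ _]; rewrite face_turn subrr. Qed.

Lemma measurable_half th : measurable (corner_hull (2 * n) 4 c r th
  : set (measurableTypeR R * measurableTypeR R)).
Proof.
rewrite half_hull_face // (_ : [set z | _] =
  [set z | face n r th 0 (z.1 - c.1, z.2 - c.2) <= 1] `&`
  [set z | face n r th 1 (z.1 - c.1, z.2 - c.2) <= 1] `&`
  [set z | face n r th 2 (z.1 - c.1, z.2 - c.2) <= 1] `&`
  [set z | face n r th (1 + n%:R) (z.1 - c.1, z.2 - c.2) <= - (1 - sigma)]); last first.
  apply/seteqP; split=> z /=; rewrite face_opp // lerN2; first by case.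
  by case=> -[[? ?] ?] ?.
by do 3!(apply: measurableI; last exact: measurable_face); exact: measurable_face.
Qed.

(** Rotation by [phi] about [c] carries [left] onto [lower]. *)
Lemma area_left : area left = area lower.
Proof.
have so : sin phi != 0 by rewrite gt_eqF // (sin_omega_gt0 n_ge2 r_gt0).
rewrite [RHS](area_rotation c so) //; last exact: measurable_half.
congr area; rewrite !half_hull_face //.
have ft t z : face n r theta t ((rotation phi c z).1 - c.1, (rotation phi c z).2 - c.2) =
    face n r (theta - phi) t (z.1 - c.1, z.2 - c.2).
  rewrite /face /rotation /=.
  have -> : theta - phi + (t + 2^-1) * phi = theta + (t + 2^-1) * phi - phi by ring.
  by set A := theta + _; rewrite (cosB A) (sinB A); congr (_ / _); ring.
by apply/seteqP; split=> z /=; rewrite !ft.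
Qed.

Lemma area_lower_le1 : area (regular_polygon (2 * n) c r theta) = 1%E ->
  (area lower <= 1)%E.
Proof.
move=> <-; apply: le_measure; rewrite ?inE; [exact: measurable_half|exact: polygon_measurable|].
by rewrite polygon_pnorm // => z /lower_pnorm.
Qed.

End HalfPolygon.

(** * From cores to freeness *)

Lemma core_area (R : realType) (V : finType) (F : V -> set (R * R)) (v : V)
    (C : set (R * R)) (alpha : R) :
  (forall u, measurable (F u : set (measurableTypeR R * measurableTypeR R))) ->
  measurable (C : set (measurableTypeR R * measurableTypeR R)) ->
  C `<=` F v -> (forall u, u != v -> C `&` F u = set0) ->
  (alpha%:E * area (F v) <= area C)%E ->
  (alpha%:E * area (F v) <=
    area (F v `\` \bigcup_(u in [set u | u != v]) F u))%E.
Proof.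
move=> mF mC CF CU aC; apply: le_trans aC _; apply: le_measure; rewrite ?inE //.
  apply: measurableD => //; apply: fin_bigcup_measurable => //.
  exact: finite_finset.
move=> z Cz; split; first exact: CF.
move=> [u uv Fu]; suff : (C `&` F u) z by rewrite CU.
by split.
Qed.

Section Cores.
Variables (R : realType) (n : nat) (r theta : R) (c : R * R).
Hypotheses (n_ge2 : (2 <= n)%N) (r_gt0 : 0 < r).
Hypothesis area1 : area (regular_polygon (2 * n) c r theta) = 1%E.
Local Notation sigma := (sigma_n R n).
Local Notation phi := (omega R n).
Local Notation lower := (corner_hull (2 * n) 4 c r theta).
Local Notation left := (corner_hull (2 * n) 4 c r (theta - phi)).
Local Notation B := (ball_at n r theta).

Lemma measurable_ball x y s : 0 < s ->
  measurable (B x y s : set (measurableTypeR R * measurableTypeR R)).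
Proof.
move=> s0; rewrite (ball_homothety theta n_ge2 r_gt0 c) //.
by apply: (measurable_homothety (_, _)); [rewrite gt_eqF|exact: polygon_measurable].
Qed.

Lemma area_ball x y s : 0 < s -> area (B x y s) = (s * s)%:E.
Proof.
move=> s0; rewrite (ball_homothety theta n_ge2 r_gt0 c) //.
rewrite (area_homothety (_, _) s0); last exact: polygon_measurable.
by rewrite area1 mule1.
Qed.

Lemma ball_le x y s s' : s <= s' -> B x y s `<=` B x y s'.
Proof. by move=> ss' z; rewrite /ball_at /= => /le_trans ->. Qed.

Lemma ball_low x y s z : B x y s z -> y - s <= - face n r theta 1 z.
Proof.
rewrite in_ball // => h.
have := le_trans (gauge_y theta n_ge2 r_gt0 _ _) h.
by rewrite ler_norml => /andP[]; lra.
Qed.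

Lemma ball_left x y s z : B x y s z -> x - s <= - face n r theta 0 z.
Proof.
rewrite in_ball // => h.
have := le_trans (gauge_x theta n_ge2 r_gt0 _ _) h.
by rewrite ler_norml => /andP[]; lra.
Qed.

Variables (V : finType) (x y s : V -> R) (alpha beta k : R).
Hypotheses (s_gt0 : forall v, 0 < s v) (k_bnd : 0 <= k <= 1 / 2).
Hypotheses (lower_area : area lower = beta%:E) (alpha_le : alpha <= (1 - k) ^+ 2 * beta).
Let F v := B (x v) (y v) (s v).
Let kap := k * sigma / 2.

Let beta_le1 : beta <= 1.
Proof. by rewrite -lee_fin -lower_area area_lower_le1. Qed.

Let kap_bnd : 0 <= kap <= k.
Proof.
have /andP[s0 s2] := sigma_n_bnd n_ge2 r_gt0; have /andP[k0 _] := k_bnd.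
rewrite /kap; have := mulr_ge0 k0 (ltW s0); have := ler_wpM2l k0 s2.
by move=> h1 h2; apply/andP; split; lra.
Qed.

Let disjoint_ball v u : (1 - kap) * s v + s u < gauge n r theta (x v - x u) (y v - y u) ->
  forall z, B (x v) (y v) ((1 - kap) * s v) z -> ~ F u z.
Proof.
move=> h z Bz Fz; have := ball_gauge n_ge2 r_gt0 Bz Fz.
by rewrite leNgt h.
Qed.

(** The case of the hubs, the chains and the huge ball. There is room to spare: [beta <= 1] and
    [kap <= k] give [alpha <= (1 - k) ^+ 2 <= (1 - kap) ^+ 2]. *)
Lemma ball_core v :
  (forall u, v <> u -> (1 - kap) * s v + s u < gauge n r theta (x v - x u) (y v - y u)) ->
  (alpha%:E * area (F v) <= area (F v `\` \bigcup_(u in [set u | u != v]) F u))%E.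
Proof.
move=> sep; have s0 := s_gt0 v; have /andP[k0 k2] := k_bnd; have /andP[K0 Kk] := kap_bnd.
have c0 : 0 < (1 - kap) * s v by rewrite mulr_gt0 //; lra.
apply: (@core_area _ _ F v (B (x v) (y v) ((1 - kap) * s v))).
- by move=> u; exact: measurable_ball.
- exact: measurable_ball.
- by apply: ball_le; rewrite ler_piMl ?(ltW s0) //; lra.
- move=> u uv; apply/seteqP; split=> // z [Bz Fz].
  by apply: (disjoint_ball (sep u _) Bz Fz) => e; rewrite e eqxx in uv.
rewrite !area_ball // -EFinM lee_fin mulrACA ler_wpM2r ?mulr_ge0 ?(ltW s0) //.
apply: le_trans alpha_le _; apply: (@le_trans _ _ ((1 - k) ^+ 2)).
  by rewrite ler_piMr // exprn_ge0 //; lra.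
by rewrite -expr2 lerXn2r ?nnegrE //; lra.
Qed.

Lemma shrunk_core (S : set (R * R)) v :
  measurable (S : set (measurableTypeR R * measurableTypeR R)) ->
  area S = area lower ->
  (forall z, S z -> pnorm n r theta (z.1 - c.1, z.2 - c.2) <= 1) ->
  (forall u, v <> u ->
     (1 - kap) * s v + s u < gauge n r theta (x v - x u) (y v - y u) \/
     forall z, shrunk n r theta c (x v) (y v) (s v) k S z -> ~ F u z) ->
  (alpha%:E * area (F v) <= area (F v `\` \bigcup_(u in [set u | u != v]) F u))%E.
Proof.
move=> mS aS S1 sep; have s0 := s_gt0 v; have /andP[k0 k2] := k_bnd; have /andP[K0 Kk] := kap_bnd.
have c0 : 0 < s v * (1 - k) by rewrite mulr_gt0 //; lra.
have sub z : shrunk n r theta c (x v) (y v) (s v) k S z ->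
    B (x v) (y v) ((1 - kap) * s v) z.
  by case=> p Sp <-; apply: shrunk_ball => //; [exact: ltW|apply/andP; split; lra|exact: S1].
apply: (@core_area _ _ F v (shrunk n r theta c (x v) (y v) (s v) k S)).
- by move=> u; exact: measurable_ball.
- by apply: measurable_homothety => //; rewrite gt_eqF.
- apply: (@subset_trans _ (B (x v) (y v) ((1 - kap) * s v))) => //.
  by apply: ball_le; rewrite ler_piMl ?(ltW s0) //; lra.
- move=> u uv; apply/seteqP; split=> // z [Bz Fz].
  have vu : v <> u by move=> e; rewrite e eqxx in uv.
  have [h|h] := sep u vu; last exact: (h z).
  exact: (disjoint_ball h (sub z Bz) Fz).
rewrite area_ball // area_homothety // aS lower_area -!EFinM lee_fin.
rewrite [leRHS](_ : _ = (1 - k) ^+ 2 * beta * (s v * s v)); last by ring.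
by rewrite ler_wpM2r // mulr_ge0 // ltW.
Qed.

Lemma lower_core v :
  (forall u, v <> u ->
     (1 - kap) * s v + s u < gauge n r theta (x v - x u) (y v - y u) \/
     y v + (sigma - 1 - kap) * s v < y u - s u) ->
  (alpha%:E * area (F v) <= area (F v `\` \bigcup_(u in [set u | u != v]) F u))%E.
Proof.
move=> sep; apply: (@shrunk_core lower) => //; first exact: measurable_half.
  by move=> z; exact: lower_pnorm.
move=> u vu; have [h|h] := sep u vu; [by left|right => z [p Sp <-] /ball_low].
rewrite face_shrunk !face1_plane //.
have /andP[k0 k2] := k_bnd; have c0 : 0 <= s v * (1 - k).
  by rewrite mulr_ge0 ?(ltW (s_gt0 v)) //; lra.
have := ler_wpM2l c0 (lower_face n_ge2 r_gt0 Sp).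
by move: h; rewrite /kap; lra.
Qed.

Lemma left_core v :
  (forall u, v <> u ->
     (1 - kap) * s v + s u < gauge n r theta (x v - x u) (y v - y u) \/
     x v + (sigma - 1 - kap) * s v < x u - s u) ->
  (alpha%:E * area (F v) <= area (F v `\` \bigcup_(u in [set u | u != v]) F u))%E.
Proof.
move=> sep; apply: (@shrunk_core left) => //; first exact: measurable_half.
- exact: area_left.
- by move=> z; exact: left_pnorm.
move=> u vu; have [h|h] := sep u vu; [by left|right => z [p Sp <-] /ball_left].
rewrite face_shrunk !face0_plane //.
have /andP[k0 k2] := k_bnd; have c0 : 0 <= s v * (1 - k).
  by rewrite mulr_ge0 ?(ltW (s_gt0 v)) //; lra.
have := ler_wpM2l c0 (left_face n_ge2 r_gt0 Sp).
by move: h; rewrite /kap; lra.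
Qed.

End Cores.

(** * Choice of the parameters *)

Lemma packing_parameters (R : realType) (N : R -> R -> R) (sigma kap : R) (w : nat) :
  0 < sigma <= 2 -> 0 < kap <= 1 / 2 -> kap <= sigma ->
  (forall x y x' y', N (x + x') (y + y') <= N x y + N x' y') ->
  (forall t x y, N (t * x) (t * y) = `|t| * N x y) ->
  (forall x y, `|x| <= N x y) -> (forall x y, `|y| <= N x y) ->
  N 1 1 <= 1 -> N 1 (1 - sigma) <= 1 -> N (1 - sigma) 1 <= 1 ->
  exists (V : sgraph) (x y s : V -> R) (half : V -> option bool),
  [/\ forall v, 0 < s v,
      forall v u, v <> u ->
        (1 - kap) * s v + s u < N (x v - x u) (y v - y u) \/
        match half v with
        | Some true => y v + (sigma - 1 - kap) * s v < y u - s u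
        | Some false => x v + (sigma - 1 - kap) * s v < x u - s u
        | None => False
        end,
      forall u v : V, edge u v <-> u != v /\ N (x u - x v) (y u - y v) <= s u + s v &
      forall (H : sgraph) l, treewidth_le H w ->
        ~ subgraph V (strong_product H (path_graph l))].
Proof.
move=> sigma_bnd kap_bnd kap_sigma N_tri N_hom N_x N_y N_diag N_left N_bot.
have /andP[kap0 kap1] := kap_bnd; have /andP[sigma0 sigma2] := sigma_bnd.
pose eta := kap / 2; have eta0 : 0 < eta by rewrite divr_gt0.
(* The ratio of consecutive scales for which [4 * s i <= eta * s i.+1] is an equality. *)
pose b := 4 / eta; have be : eta * b = 4 by rewrite /b mulrC divfK // gt_eqF.
have b1 : 1 <= b by rewrite ler_pdivlMr // mul1r /eta; lra.
pose s (i : nat) := b ^+ i; pose g := (4 * w.+1).+1; pose W := b ^+ g.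
have s_ge1 i : 1 <= s i by rewrite exprn_ege1.
have s_le i : (i < g)%N -> s i <= W by move=> ig; rewrite ler_weXn2l // ltnW.
have s_inc i j : (i < j)%N -> 4 * s i <= eta * s j.
  move=> ij; have : s i.+1 <= s j by rewrite ler_weXn2l.
  by rewrite -(ler_pM2l eta0) /s exprS mulrA be.
pose S := 64 * W / kap; pose m := eta / 16 / S; pose X := 32 * W / m.
have W1 : 1 <= W by rewrite exprn_ege1.
have S0 : 0 < S by rewrite divr_gt0 // mulr_gt0 //; lra.
have m0 : 0 < m by rewrite divr_gt0 // divr_gt0.
have S_big : 64 * W <= kap * S by rewrite /S (mulrC kap) divfK // gt_eqF.
have mS : m * S = eta / 16 by rewrite /m divfK // gt_eqF.
have mX : m * X = 32 * W by rewrite /X mulrC divfK // gt_eqF.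
pose Z := N 1 m * (N 0 1 * (32 * W) + N 1 m * X) / (eta / 8).
have [K K_gt0 K_big] : exists2 K : nat, (0 < K)%N &
    N 1 m * (N 0 1 * (32 * W) + N 1 m * X) <= K%:R * (eta / 8).
  exists (Num.bound `|Z|).+1 => //; rewrite -ler_pdivrMr ?divr_gt0 // -/Z.
  apply: le_trans (ler_norm Z) (le_trans (ltW (archi_boundP (normr_ge0 Z))) _).
  by rewrite ler_nat.
have eta_bnd : [/\ 0 < eta, eta <= 1 / 2, eta <= sigma / 2 & eta < kap].
  by split=> //; rewrite /eta; lra.
have kap_le1 : kap <= 1 by lra.
(* The radius [G + 2 * K + 6] becomes [2 * G - 1], so a product structure would give
   [G * g <= w.+1 * (4 * G - 1)], contrary to [g = 4 * w.+1 + 1]. *)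
pose G := (2 * K + 7)%N.
have [r_gt0 free order] := packing_spec N_tri N_hom N_x N_y N_diag N_left N_bot
  sigma_bnd eta_bnd kap_le1 s_ge1 s_inc s_le W1 S_big mS mX K_gt0 K_big
  G (G * g)%N.
exists (contact_graph sigma eta N_hom s g W S m X K G (G * g)), (@vx _ N sigma eta s g S m X K G (G * g)),
  (@vy _ N sigma eta s g W S m X K G (G * g)), (@vr _ N sigma eta s g W S m X K G (G * g)),
  (fun v => if v is Some (inr (_, inl h)) then Some h else None).
split.
- exact: r_gt0.
- move=> v u vu; have [h|h] := free v u vu; [by left|right].
  move: h; case: v {vu} => [[?|[? [[]|?]]]|] h; exact: h.
- by move=> u v; split=> [/andP[]|[uv h]]; last by apply/andP.
move=> H l tw sub; move: (order H l w erefl tw sub).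
by rewrite /G /g; clear; lia.
Qed.

Theorem theorem3 (R : realType) (n : nat) (c : R * R) (r theta alpha : R) :
  (2 <= n)%N ->
  0 < r ->
  area (regular_polygon (2 * n) c r theta) = 1%E ->
  0 <= alpha <= 1 ->
  (alpha%:E < area (corner_hull (2 * n) 4 c r theta))%E ->
  ~ admits_product_structure
      (free_intersection_class (regular_polygon (2 * n) c r theta) alpha).
Proof.
move=> n2 r0 area1 /andP[alpha0 _] alpha_lt [w product].
have := area_lower_le1 n2 r0 area1; case E: (area _) alpha_lt => [beta| |] //.
rewrite lte_fin lee_fin => alpha_lt beta1.
have /andP[sigma0 sigma2] := sigma_n_bnd n2 r0 (R := R).
have beta0 : 0 < beta by lra.
(* The first-order loss of [(1 - k) ^+ 2 * beta] is made to use up [beta - alpha] exactly; the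
   square term is a gain. *)
have [k kb] : exists k, 2 * (k * beta) = beta - alpha.
  by exists ((beta - alpha) / (2 * beta)); field; rewrite gt_eqF.
have k0 : 0 < k by rewrite -(pmulr_lgt0 _ beta0); lra.
have k1 : k <= 1 / 2 by rewrite -(ler_pM2r beta0); lra.
have alpha_le : alpha <= (1 - k) ^+ 2 * beta.
  have kkb := mulr_ge0 (sqr_ge0 k) (ltW beta0).
  by rewrite [leRHS](_ : _ = beta - 2 * (k * beta) + k ^+ 2 * beta); [lra|ring].
have ks : k * sigma_n R n <= 1 / 2 * sigma_n R n by rewrite ler_wpM2r // ltW.
have ks0 : 0 < k * sigma_n R n by rewrite mulr_gt0.
have [||V [x [y [s [half [s_gt0 sep edgeE no_product]]]]]] :=
  @packing_parameters R (gauge n r theta) (sigma_n R n) (k * sigma_n R n / 2) w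
    (sigma_n_bnd n2 r0) _ _ (gauge_tri theta n2 r0) (gauge_hom theta n2 r0)
    (gauge_x theta n2 r0) (gauge_y theta n2 r0) (gauge_diag theta n2 r0)
    (gauge_left theta n2 r0) (gauge_bot theta n2 r0).
- by apply/andP; split; lra.
- lra.
have [|H [l [tw sub]]] := product V; last exact: no_product tw sub.
have k_bnd : 0 <= k <= 1 / 2 by rewrite k1 ltW.
exists (fun v => ball_at n r theta (x v) (y v) (s v)); split.
- move=> v; exists (s v), ((plane n r theta (x v) (y v)).1 - s v * c.1,
    (plane n r theta (x v) (y v)).2 - s v * c.2).
  by split=> //; exact: ball_homothety.
- move=> v; case hv: (half v) => [[]|].
  + by apply: (lower_core n2 r0 area1 s_gt0 k_bnd E alpha_le) => u /sep; rewrite hv.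
  + by apply: (left_core n2 r0 area1 s_gt0 k_bnd E alpha_le) => u /sep; rewrite hv.
  + apply: (ball_core n2 r0 area1 s_gt0 k_bnd E alpha_le) => u /sep; rewrite hv.
    by case.
- by move=> u v; rewrite edgeE ball_meet.
Qed.
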